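(* Let $(\Sigma_3,\sigma)$ be the full shift on three symbols $\{1,2,3\}$. For a sequence $(a_n)_{n\ge 0}$ of real numbers with $a_n\to 0$, let $\phi:\Sigma_3\to\mathbb{R}$ be the grid function defined by $(a_n)_n$ and let $p_\phi(t):=P(t\phi)$, $t\in\mathbb{R}$. Then: (1) there exists $(a_n)_n$ such that $D^-p_\phi(1)<0$, but $p_\phi(t)=\log 2$ for all $t\ge 1$; (2) there exist $(a_n)_n$ and $t_1>1$ such that $D^-p_\phi(1)<0$, $p_\phi(t)=\log 2$ for all $t\in[1,t_1]$, and $Dp_\phi(t)>0$ for all $t>t_1$; (3) there exists $(a_n)_n$ such that $Dp_\phi(t)<0$ for $t<1$, but $p_\phi$ is $C^1$ at $t=1$ and $p_\phi(t)=\log 2$ for all $t\ge 1$; (4) there exist $(a_n)_n$ and $t_1>1$ such that $Dp_\phi(t)<0$ for $t<1$, but $p_\phi$ is $C^1$ at $t=1$, $p_\phi(t)=\log 2$ for all $t\in[1,t_1]$, and $Dp_\phi(t)>0$ for all $t>t_1$.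
   Context: $\Sigma_3=\{1,2,3\}^{\mathbb{N}_0}$ with the product topology, points $x=(x_0x_1x_2\dots)$, and $\sigma$ is the left shift. Let $B=\{1,3\}^{\mathbb{N}_0}\subset\Sigma_3$. Let $M_0=\{x: x_0=2\}$ and, for $n\ge1$, $M_n=\{x: x_0,\dots,x_{n-1}\in\{1,3\},\ x_n=2\}$ (points whose first visit to $[2]:=\{x:x_0=2\}$ occurs at time $n$). The grid function defined by a real sequence $(a_n)_{n\ge0}$ with $a_n\to0$ is $\phi=\sum_{n=0}^\infty a_n\mathbb{1}_{M_n}$; thus $\phi|_B=0$. Pressure: for a Borel map $f:X\to X$ of a metric space and a Borel potential $\varphi$, $P(\varphi)=\sup\{h(\mu)+\int\varphi\,d\mu\}$, the supremum over $f$-invariant Borel probability measures $\mu$ with $-\int\varphi\,d\mu<\infty$, where $h(\mu)$ is the measure-theoretic entropy. $D^-$ denotes the left derivative and $D$ the derivative with respect to $t$. *)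

(* Defs.v *)
From HB Require Import structures.
From mathcomp Require Import all_boot all_order all_algebra.
From mathcomp Require Import all_classical all_reals all_analysis.
Import Order.TTheory GRing.Theory Num.Theory.
Import numFieldNormedType.Exports.

Set Implicit Arguments.
Unset Strict Implicit.
Unset Printing Implicit Defensive.

Local Open Scope classical_set_scope.
Local Open Scope ring_scope.

Definition invariant_measure d (X : measurableType d) (R : realType)
    (f : X -> X) (mu : {measure set X -> \bar R}) : Prop :=
  forall A : set X, measurable A -> mu (f @^-1` A) = mu A.

Definition measurable_partition d (X : measurableType d) (k : nat)
    (A : 'I_k -> set X) : Prop :=
  [/\ forall j, measurable (A j),
      trivIset [set: 'I_k] A &
      \bigcup_(j in [set: 'I_k]) A j = [set: X]].

(* The atom of the join of f^-i(A), 0 <= i < n, with itinerary w; some of the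
   k ^ n itineraries may give the empty set, which contributes 0 to the
   entropy. *)
Definition join_atom (X : Type) (f : X -> X) (k : nat) (A : 'I_k -> set X)
    (n : nat) (w : {ffun 'I_n -> 'I_k}) : set X :=
  \bigcap_(i in [set: 'I_n]) (iter i f) @^-1` A (w i).

(* [ln 0 = 0] in the library, so atoms of measure zero contribute 0. *)
Definition join_entropy d (X : measurableType d) (R : realType)
    (f : X -> X) (mu : probability X R) (k : nat) (A : 'I_k -> set X)
    (n : nat) : R :=
  - \sum_(w : {ffun 'I_n -> 'I_k})
      (let m := fine (mu (join_atom f A w)) in m * ln m).

Definition partition_entropy d (X : measurableType d) (R : realType)
    (f : X -> X) (mu : probability X R) (k : nat) (A : 'I_k -> set X) : R :=
  limn (fun n : nat => join_entropy f mu A n / n%:R).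

Definition entropy d (X : measurableType d) (R : realType)
    (f : X -> X) (mu : probability X R) : \bar R :=
  ereal_sup [set h | exists (k : nat) (A : 'I_k -> set X),
    measurable_partition A /\ h = (partition_entropy f mu A)%:E].

Definition pressure d (X : measurableType d) (R : realType)
    (f : X -> X) (phi : X -> R) : \bar R :=
  ereal_sup [set v | exists mu : probability X R,
    [/\ invariant_measure f mu,
        (- (\int[mu]_x (phi x)%:E) < +oo)%E &
        v = (entropy f mu + \int[mu]_x (phi x)%:E)%E]].

(* The symbols 1, 2, 3 are the elements 0, 1, 2 of 'I_3. *)
Definition symbol : Type := 'I_3.

HB.instance Definition _ := Finite.on symbol.

Definition sym1 : symbol := @Ordinal 3 0 isT.
Definition sym2 : symbol := @Ordinal 3 1 isT.
Definition sym3 : symbol := @Ordinal 3 2 isT.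

HB.instance Definition _ := isPointed.Build symbol sym1.

Definition Sigma3 : Type :=
  prod_topology (fun _ : nat => discrete_topology symbol).

HB.instance Definition _ := Pointed.on Sigma3.
HB.instance Definition _ := Topological.on Sigma3.

Definition borel_Sigma3 := g_sigma_algebraType (@open Sigma3).

Definition shift (x : Sigma3) : Sigma3 := fun n => x n.+1.

Definition first_visit (n : nat) : set Sigma3 :=
  [set x | (forall i : nat, (i < n)%N -> x i = sym1 \/ x i = sym3) /\
           x n = sym2].

(* The sets [first_visit n] are pairwise disjoint: the series has at most one
   nonzero term at every point. *)
Definition grid_function (R : realType) (a : nat -> R) (x : Sigma3) : R :=
  limn (series (fun n : nat => a n * \1_(first_visit n) x)).

(* The pressure of [t * grid_function a] is finite, because the potential is
   bounded and the entropy of the shift is at most [ln 3]; [fine] only turns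
   it into a real number. *)
Definition pressure_function (R : realType) (a : nat -> R) (t : R) : R :=
  fine (pressure (shift : borel_Sigma3 -> borel_Sigma3)
          (fun x : borel_Sigma3 => t * grid_function a x)).

Definition is_left_derive (R : realType) (p : R -> R) (t l : R) : Prop :=
  (h^-1 * (p (t + h) - p t)) @[h --> 0^'-] --> l.

Definition C1_at (R : realType) (p : R -> R) (t : R) : Prop :=
  (\forall s \near t, derivable p s 1) /\ {for t, continuous (derive1 p)}.

(* Main.v *)
(* Excursions from the cylinder [2]: the Birkhoff sum of the grid function along
   an excursion 2 w 2 with w in {1,3}^n is S_n = a_0 + ... + a_n, and there are
   2^n such words w.  Hence P(t phi) = log 2 + q, where q >= 0 is the least number
   with sum_n exp(t S_n - (n+1) q) <= 2.

   Upper bound: weighting a word by the exponential of its excursion sums gives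
   an almost-Gibbs sub-probability nu on words.  For an arbitrary finite partition
   A, approximate its labels by cylinder labels up to small measure; Gibbs'
   inequality against the mixture over u of nu(u) and a noisy channel from the
   labels of u to those of A bounds H_n(A) directly, so that no generator theorem
   is needed.

   Lower bound: if a truncation of the series exceeds 2, the stationary renewal
   process with the normalised truncated excursion weights is an invariant measure
   whose entropy is computed by the same Birkhoff sums.

   The four examples are exp(S_n) ~ n^-2 (infinite mean return time, C^1
   transition) and exp(S_n) ~ n^-3 (finite mean, first order transition), both with
   sum exp(S_n) = 2; making a_0 slightly positive creates the second transition. *)

Require Import Defs.
From mathcomp Require Import all_boot all_order all_algebra finmap.
From mathcomp Require Import all_classical all_reals all_analysis.
From mathcomp Require Import measurable_realfun zify ring lra.
(* Again, since [all_analysis] also exports a [shift]. *)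
Import Defs.
Import Order.TTheory GRing.Theory Num.Theory.
Import numFieldNormedType.Exports.

Set Implicit Arguments.
Unset Strict Implicit.
Unset Printing Implicit Defensive.

Local Open Scope classical_set_scope.
Local Open Scope ring_scope.

(** * Cylinders of the full shift *)

(** The constant 2 comes from splitting off log 2: an excursion with n letters in {1,3} lasts n+1
    steps and has 2^n versions, so sum 2^n exp(t S_n - (n+1)(log 2 + q)) = 1 turns into sum exp(t
    S_n - (n+1) q) = 2. The excess [Q t] of the pressure over log 2 is then known only through two
    tests on finite partial sums: if all are at most 2 then [Q t <= q]; if one is at least 2 then
    [q <= Q t]. Where [Q t > 0], sublinearity of S_n makes the terms decay exponentially, so moments
    converge, the sum equals 2 exactly, and the equation can be differentiated. At t = 1 this decay
    is lost because [Q 1 = 0]. Formally the slope there is sum S_n exp(S_n) divided by sum (n+1)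
    exp(S_n), with negative numerator, so the size of the denominator decides between a corner and a
    smooth contact. Convexity of the pressure enters only through supporting lines of [Q] and
    tangent inequalities for the exponential. *)

Notation bshift := (shift : borel_Sigma3 -> borel_Sigma3) (only parsing).

Lemma open_coord (i : nat) (a : symbol) : open [set x : Sigma3 | x i = a].
Proof.
have H : continuous ((fun x => x i) : Sigma3 -> discrete_topology symbol).
  exact: (@proj_continuous nat (fun _ => discrete_topology symbol) i).
move/continuousP : H => /(_ [set a]).
by apply; exact: discrete_open.
Qed.

(** A basic neighbourhood in the product is a finite intersection of conditions on single
    coordinates; [n] is found by induction on the list of conditions. *)
Lemma open_prefix (U : set Sigma3) (x : Sigma3) : open U -> U x ->
  exists n, forall y : Sigma3, (forall i, (i < n)%N -> y i = x i) -> U y.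
Proof.
move=> oU Ux.
have : nbhs x U by exact: open_nbhs_nbhs.
case=> [_ [[B sB <-] [C BC Cx] sUBA]].
have [D sD IDeC] := sB _ BC.
have loc E : E \in D -> exists i : nat, forall y : Sigma3, y i = x i -> E y.
  move=> ED; have /set_mem[i _ [V oV VE]] := sD _ ED.
  exists i => y yx; have : E x by move: Cx; rewrite -IDeC; apply.
  by rewrite -VE /= yx.
suff [n nD] : exists n, forall y : Sigma3, (forall i, (i < n)%N -> y i = x i) ->
    forall E, E \in (D : seq _) -> E y.
  exists n => y /nD yD; apply: sUBA; exists C => //.
  by rewrite -[isBaseTopological.b _]/C -IDeC => E ED; exact: yD.
have : {subset (D : seq _) <= D} by [].
elim: (D : seq _) => [_|E s IH sED]; first by exists 0%N.
have [|n ns] := IH; first by move=> F Fs; apply: sED; rewrite inE Fs orbT.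
have [|i iE] := loc E; first by apply: sED; rewrite inE eqxx.
exists (maxn n i.+1) => y yx F; rewrite inE => /orP[/eqP->|Fs].
  by apply: iE; apply: yx; rewrite leq_max ltnSn orbT.
by apply: ns Fs => j jn; apply: yx; rewrite leq_max jn.
Qed.

Definition prefix (n : nat) (x : Sigma3) : seq symbol := mkseq x n.

Lemma eq_prefixP n (x y : Sigma3) :
  prefix n y = prefix n x <-> (forall i, (i < n)%N -> y i = x i).
Proof.
split=> [E i ni|E].
  by rewrite -(nth_mkseq sym1 y ni) -/(prefix n y) E nth_mkseq.
by apply/eq_in_map => i; rewrite mem_iota /= add0n => /E.
Qed.

Definition cyl (u : seq symbol) : set borel_Sigma3 :=
  [set x | prefix (size u) x = u].

Lemma prefixS n (x : Sigma3) : prefix n.+1 x = x 0%N :: prefix n (shift x).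
Proof.
by rewrite /prefix /mkseq /= -[1%N]addn0 iotaDl -map_comp.
Qed.

Lemma take_prefix m n (x : Sigma3) : (m <= n)%N -> take m (prefix n x) = prefix m x.
Proof. by move=> mn; rewrite /prefix /mkseq -map_take take_iota (minn_idPl mn). Qed.

Lemma drop_prefix m n (x : Sigma3) :
  drop m (prefix (m + n) x) = prefix n (iter m shift x).
Proof.
elim: m x => [|m IH] x; first by rewrite drop0.
by rewrite addSn prefixS /= IH -iterS -iterSr.
Qed.

Lemma iter_shift n (x : Sigma3) i : iter n shift x i = x (n + i)%N.
Proof. by elim: n i => //= n IH i; rewrite /shift IH addnS. Qed.


Lemma cylE u : cyl u = \bigcap_(i in `I_(size u)) [set x | x i = nth sym1 u i].
Proof.
apply/seteqP; split=> x.
  by move=> xu i iu /=; rewrite -[in RHS](xu : prefix _ _ = _) nth_mkseq.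
move=> xu; apply: (@eq_from_nth _ sym1); first by rewrite size_mkseq.
by move=> i; rewrite size_mkseq => iu; rewrite nth_mkseq//; exact: xu.
Qed.

Lemma measurable_coord i a : measurable ([set x | x i = a] : set borel_Sigma3).
Proof. by apply: sub_sigma_algebra; exact: open_coord. Qed.

Lemma measurable_cyl u : measurable (cyl u).
Proof.
by rewrite cylE; apply: bigcap_measurableType => i _; exact: measurable_coord.
Qed.

Lemma open_bigcup_cyl (U : set Sigma3) : open U ->
  U = \bigcup_(u in [set u | cyl u `<=` U]) cyl u.
Proof.
move=> oU; apply/seteqP; split=> [x Ux|x [u /= uU]]; last exact: uU.
have [n nU] := open_prefix oU Ux.
exists (prefix n x); last by rewrite /cyl /= size_mkseq.
move=> y; rewrite /cyl /= size_mkseq => /eq_prefixP yx; exact: nU.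
Qed.

(** Words are countable, so an open set is a countable union of cylinders. The empty set is added to
    make the generators closed under intersection, as uniqueness of measures requires. *)
Lemma measurable_Sigma3E :
  (measurable : set (set borel_Sigma3)) = <<s [set A | A = set0 \/ exists u, A = cyl u] >>.
Proof.
apply/seteqP; split.
  apply: smallest_sub; first exact: smallest_sigma_algebra.
  move=> U oU; rewrite (open_bigcup_cyl oU) bigcup_mkcond.
  pose G := [set A : set borel_Sigma3 | A = set0 \/ exists u, A = cyl u].
  apply: (@countable_bigcupT_measurable _ (g_sigma_algebraType G)) => [|u].
    exact: countableP.
  by apply: sub_sigma_algebra; case: ifP => _; [right; exists u|left].
apply: smallest_sub; first exact: sigma_algebra_measurable.
by move=> _ [->//|[u ->]]; exact: measurable_cyl.
Qed.

Lemma cylI u v : cyl u `&` cyl v = set0 \/ exists w, cyl u `&` cyl v = cyl w.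
Proof.
wlog uv : u v / (size u <= size v)%N.
  by case: (leqP (size u) (size v)) => [|/ltnW] /[swap] /[apply] //; rewrite setIC.
have [uE|/eqP uN] := eqVneq (take (size u) v) u.
  right; exists v; rewrite setIC; apply/setIidPl => x xv; rewrite /cyl /=.
  by rewrite -(take_prefix _ uv) (xv : prefix _ _ = _).
left; apply/seteqP; split=> x //= -[xu xv]; apply: uN.
by rewrite -(xv : prefix _ _ = _) take_prefix.
Qed.

Lemma measurable_shift : measurable_fun setT bshift.
Proof.
apply: (measurability [set A : set borel_Sigma3 | A = set0 \/ exists u, A = cyl u]).
  by rewrite measurable_Sigma3E.
move=> _ [_ [->|[u ->]] <-]; rewrite setTI ?preimage_set0 //.
rewrite (_ : shift @^-1` _ = \bigcup_(a in [set: symbol]) cyl (a :: u)).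
  by apply: countable_bigcupT_measurable => // a; exact: measurable_cyl.
apply/seteqP; split=> x.
  by move=> xu; exists (x 0%N) => //; rewrite /cyl /= prefixS (xu : prefix _ _ = _).
by move=> [a _]; rewrite /cyl /= prefixS => -[].
Qed.

Lemma cyl_unique (R : realType) (m1 m2 : {measure set borel_Sigma3 -> \bar R}) :
  (m1 setT < +oo)%E -> (forall u, m1 (cyl u) = m2 (cyl u)) ->
  forall A, measurable A -> m1 A = m2 A.
Proof.
move=> m1oo m12.
apply: (measure_unique [set A | A = set0 \/ exists u, A = cyl u] (fun=> setT)) => //.
- exact: measurable_Sigma3E.
- move=> _ _ [->|[u ->]] [->|[v ->]]; rewrite ?setI0 ?set0I; first [by left|exact: cylI].
- by move=> _; right; exists [::]; apply/seteqP; split=> x.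
- by rewrite bigcup_const//; exists 0%N.
- by move=> _ [->|[u ->]] //; rewrite !measure0.
Qed.

(** * Approximation of measurable sets by cylinders *)

(** A finite union of cylinders of length [N], encoded by a Boolean test on words so that set
    operations become operations on tests. *)
Definition cylset (N : nat) (c : seq symbol -> bool) : set borel_Sigma3 :=
  [set x | c (prefix N x)].

Lemma measurable_cylset N c : measurable (cylset N c).
Proof.
rewrite (_ : cylset N c =
    \bigcup_u (if (size u == N) && c u then cyl u else set0)).
  apply: countable_bigcupT_measurable => [|u]; first exact: countableP.
  by case: ifP => // _; exact: measurable_cyl.
apply/seteqP; split=> x; rewrite /cylset /=.
  move=> cx; exists (prefix N x) => //.
  by rewrite size_mkseq eqxx cx /cyl /= size_mkseq.
move=> [u _]; case: ifP => // /andP[/eqP <- cu].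
by rewrite /cyl /= => ->.
Qed.

Section approximation.
Context {R : realType} (mu : probability borel_Sigma3 R).

Definition approximable (A : set borel_Sigma3) := measurable A /\
  forall e : R, 0 < e -> exists N c,
    (mu ((A `\` cylset N c) `|` (cylset N c `\` A)) < e%:E)%E.

Lemma approximableU A B : approximable A -> approximable B ->
  approximable (A `|` B).
Proof.
move=> [mA hA] [mB hB]; split; first exact: measurableU.
move=> e e0; have e20 : 0 < e / 2 by rewrite divr_gt0.
have [N [c hc]] := hA _ e20; have [N' [c' hc']] := hB _ e20.
exists (maxn N N'), (fun u => c (take N u) || c' (take N' u)).
have mc := measurable_cylset N c; have mc' := measurable_cylset N' c'.
have -> : cylset (maxn N N') (fun u => c (take N u) || c' (take N' u)) =
    cylset N c `|` cylset N' c'.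
  apply/seteqP; split=> x; rewrite /cylset /= !take_prefix ?leq_maxl ?leq_maxr //.
    by move/orP.
  by move=> h; apply/orP.
apply: (@le_lt_trans _ _ (mu (((A `\` cylset N c) `|` (cylset N c `\` A)) `|`
   ((B `\` cylset N' c') `|` (cylset N' c' `\` B))))).
  apply: le_measure; rewrite ?inE.
  - by apply: measurableU; apply: measurableD => //; exact: measurableU.
  - by repeat (apply: measurableU || apply: measurableD).
  - move=> x /=; tauto.
apply: le_lt_trans (measureU2 _ _ _) _.
- by apply: measurableU; exact: measurableD.
- by apply: measurableU; exact: measurableD.
by rewrite [e]splitr EFinD lteD.
Qed.

Lemma approximable_cyl u : approximable (cyl u).
Proof.
split; first exact: measurable_cyl.
move=> e e0; exists (size u), (fun v => v == u).
rewrite (_ : cylset _ _ = cyl u); first by rewrite setDv setU0 measure0 lte_fin.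
by apply/seteqP; split=> x; rewrite /cylset /cyl /= => /eqP.
Qed.

Lemma approximable_bigcup (F : nat -> set borel_Sigma3) :
  (forall n, approximable (F n)) -> approximable (\bigcup_n F n).
Proof.
move=> aF; have mF n : measurable (F n) by have [] := aF n.
split; first exact: bigcupT_measurable.
move=> e e0; have e20 : 0 < e / 2 by rewrite divr_gt0.
pose G n := \bigcup_(i in `I_n.+1) F i.
have GS n : G n.+1 = G n `|` F n.+1 by rewrite /G bigcup_mkord big_ord_recr /= -bigcup_mkord.
have aG n : approximable (G n).
  elim: n => [|n IH]; last by rewrite GS; exact: approximableU.
  by rewrite /G bigcup_mkord big_ord_recr big_ord0 /= set0U.
have mG n : measurable (G n) by have [] := aG n.
have UG : \bigcup_n G n = \bigcup_n F n.
  apply/seteqP; split=> [x [n _ [i _ Fi]]|x [n _ Fn]]; first by exists i.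
  by exists n => //; exists n => /=.
(* Continuity from below: a finite union [G n] already has the measure of the whole union up to
   [e / 2]. *)
have : mu (G n) @[n --> \oo] --> mu (\bigcup_n F n).
  rewrite -UG; apply: nondecreasing_cvg_mu => //; first by rewrite UG; exact: bigcupT_measurable.
  apply/nondecreasing_seqP => n; apply/subsetPset; rewrite GS; exact: subsetUl.
have fin A : measurable A -> mu A \is a fin_num.
  by move=> mA; apply: fin_num_measure.
rewrite -(fineK (fin _ (bigcupT_measurable _ mF))).
move/fine_cvgP => [_ /cvgrPdist_lt /(_ _ e20)] [n _ /(_ n (leqnn n))] /=.
move=> hn; have [N [c hc]] := (aG n).2 _ e20; exists N, c.
have mc := measurable_cylset N c.
have sG : G n `<=` \bigcup_n F n by rewrite -UG; exact: bigcup_sup.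
have mUF : measurable (\bigcup_n F n) by exact: bigcupT_measurable.
apply: (@le_lt_trans _ _ (mu (((G n `\` cylset N c) `|` (cylset N c `\` G n)) `|`
   ((\bigcup_n F n) `\` G n)))).
  apply: le_measure; rewrite ?inE.
  - by apply: measurableU; apply: measurableD.
  - by apply: measurableU; [apply: measurableU|]; exact: measurableD.
  - move=> x /=; have := sG x.
    by case: (pselect (G n x)); case: (pselect ((\bigcup_n F n) x)); tauto.
apply: le_lt_trans (measureU2 _ _ _) _.
- by apply: measurableU; exact: measurableD.
- exact: measurableD.
rewrite [e]splitr EFinD lteD// measureD//; last first.
  by rewrite ltey_eq fin.
rewrite setIidr //.
rewrite -[X in (X - _)%E](fineK (fin _ mUF)) -[X in (_ - X)%E](fineK (fin _ (mG n))).
rewrite -EFinB lte_fin.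
by apply: le_lt_trans hn; rewrite ler_norm.
Qed.

(** Approximable sets form a sigma-algebra containing the cylinders. *)
Lemma measurable_approximable A : measurable A -> approximable A.
Proof.
rewrite measurable_Sigma3E; move: A; apply: smallest_sub.
  split.
  - split=> // e e0; exists 0%N, (fun=> false).
    rewrite (_ : cylset _ _ = set0); last by apply/seteqP; split=> x.
    by rewrite !set0D set0U measure0 lte_fin.
  - move=> A [mA hA]; split; first exact: measurableD.
    move=> e /hA[N [c h]]; exists N, (fun u => ~~ c u).
    congr (mu _ < _)%E: h; rewrite (_ : cylset N (fun u => ~~ c u) = ~` cylset N c).
      apply/seteqP; split=> x /=; have := EM (A x); have := EM (cylset N c x); tauto.
    by apply/seteqP; split=> x /=; [move/negP|move=> ?; apply/negP].
  - exact: approximable_bigcup.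
move=> _ [->|[u ->]]; last exact: approximable_cyl.
split=> // e e0; exists 0%N, (fun=> false).
rewrite (_ : cylset _ _ = set0); last by apply/seteqP; split=> x.
by rewrite !set0D set0U measure0 lte_fin.
Qed.

End approximation.

(** * Itineraries and the inequality of Gibbs *)

Section bounded_expectation.
Context d (X : measurableType d) (R : realType) (mu : probability X R).
Implicit Types (f g : X -> R).

(** Under a probability such functions are integrable, so [expect] is a linear and monotone
    functional with real values and infinities never occur. *)
Definition bounded_measurable f :=
  measurable_fun setT f /\ exists M, forall x, `|f x| <= M.

Lemma bounded_measurable_integrable f : bounded_measurable f ->
  mu.-integrable setT (EFin \o f).
Proof.
move=> [mf [M fM]]; apply: measurable_bounded_integrable => //.
  by rewrite /= probability_setT ltry.
exists M; split; first exact: num_real.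
by move=> r Mr x _; exact: le_trans (ltW Mr).
Qed.

Lemma bounded_measurable_cst c : bounded_measurable (cst c).
Proof. by split; [exact: measurable_cst|exists `|c|]. Qed.

Lemma bounded_measurableD f g : bounded_measurable f -> bounded_measurable g ->
  bounded_measurable (fun x => f x + g x).
Proof.
move=> [mf [M fM]] [mg [N gN]]; split; first exact: measurable_funD.
by exists (M + N) => x; apply: le_trans (ler_normD _ _) _; exact: lerD.
Qed.

Lemma bounded_measurableZ c f : bounded_measurable f ->
  bounded_measurable (fun x => c * f x).
Proof.
move=> [mf [M fM]]; split; first by apply: measurable_funM.
by exists (`|c| * M) => x; rewrite normrM ler_wpM2l.
Qed.

Lemma bounded_measurable_comp f (T : X -> X) : measurable_fun setT T ->
  bounded_measurable f -> bounded_measurable (f \o T).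
Proof.
move=> mT [mf [M fM]]; split; first exact: measurableT_comp.
by exists M => x; exact: fM.
Qed.

Lemma bounded_measurable_indic (A : set X) : measurable A ->
  bounded_measurable (\1_A : X -> R).
Proof.
move=> mA; split; first exact: measurable_indic.
by exists 1 => x; rewrite indicE ger0_norm // lern1 leq_b1.
Qed.

Lemma bounded_measurable_sum (I : Type) (s : seq I) (F : I -> X -> R) :
  (forall i, bounded_measurable (F i)) ->
  bounded_measurable (fun x => \sum_(i <- s) F i x).
Proof.
move=> bF; elim: s => [|i s IH].
  by under eq_fun do rewrite big_nil; exact: bounded_measurable_cst.
by under eq_fun do rewrite big_cons; exact: bounded_measurableD.
Qed.

Definition expect f : R := \int[mu]_x f x.

Lemma expectD f g : bounded_measurable f -> bounded_measurable g ->
  expect (fun x => f x + g x) = expect f + expect g.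
Proof. by move=> bf bg; apply: RintegralD => //; exact: bounded_measurable_integrable. Qed.

Lemma expectZ c f : bounded_measurable f ->
  expect (fun x => c * f x) = c * expect f.
Proof. by move=> bf; apply: RintegralZl => //; exact: bounded_measurable_integrable. Qed.

Lemma expect_cst c : expect (cst c) = c.
Proof. rewrite /expect Rintegral_cst//. by have /= -> := @probability_setT _ _ _ mu; rewrite mulr1. Qed.

Lemma expect_indic (A : set X) : measurable A -> expect \1_A = fine (mu A).
Proof. by move=> mA; rewrite /expect /Rintegral integral_indic// setIT. Qed.

Lemma expect_le f g : bounded_measurable f -> bounded_measurable g ->
  (forall x, f x <= g x) -> expect f <= expect g.
Proof.
by move=> bf bg fg; apply: le_Rintegral => //; exact: bounded_measurable_integrable.
Qed.

Lemma expect_sum (I : Type) (s : seq I) (F : I -> X -> R) :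
  (forall i, bounded_measurable (F i)) ->
  expect (fun x => \sum_(i <- s) F i x) = \sum_(i <- s) expect (F i).
Proof.
move=> bF; elim: s => [|i s IH].
  by rewrite big_nil -[RHS](expect_cst 0); congr expect; apply: funext => x; rewrite big_nil.
rewrite big_cons -IH -expectD //; last exact: bounded_measurable_sum.
by congr expect; apply: funext => x; rewrite big_cons.
Qed.

Lemma expect_invariant f (T : X -> X) : measurable_fun setT T ->
  invariant_measure T mu -> bounded_measurable f ->
  expect (f \o T) = expect f.
Proof.
move=> mT invT bf; rewrite /expect /Rintegral; congr fine.
have if1 := bounded_measurable_integrable (bounded_measurable_comp mT bf).
have [/measurable_EFinP mf _] := bf.
transitivity (\int[pushforward mu T]_y (f y)%:E)%E.
  by rewrite integral_pushforward // -?preimage_setT.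
by apply: eq_measure_integral => A mA _; exact: invT.
Qed.

(** With a labelling function, atoms of a join become fibres of [itinerary] and sums over atoms
    become expectations. *)
Lemma partition_label k (A : 'I_k -> set X) : measurable_partition A ->
  exists al : X -> 'I_k, forall j, A j = [set x | al x = j].
Proof.
move=> [_ tA UA].
have al x : {j | A j x}.
  by apply: cid; have : setT x by []; rewrite -UA => -[j _ Ajx]; exists j.
exists (fun x => sval (al x)) => j; apply/seteqP; split=> x /=; case: al => i //= Aix.
  move=> Ajx; have /trivIsetP H := tA.
  apply/eqP/negPn/negP => /(H i j Logic.I Logic.I) /eqP.
  by apply/negP/set0P; exists x.
by move=> <-.
Qed.

Definition itinerary (T : X -> X) k (al : X -> 'I_k) n (x : X) : {ffun 'I_n -> 'I_k} :=
  [ffun i : 'I_n => al (iter i T x)].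

Section itineraries.
Variables (T : X -> X) (mT : measurable_fun setT T).
Variables (k : nat) (A : 'I_k -> set X) (mA : forall j, measurable (A j)).
Variables (al : X -> 'I_k) (Aal : forall j, A j = [set x | al x = j]).

Lemma join_atomE n (w : {ffun 'I_n -> 'I_k}) :
  join_atom T A w = [set x | itinerary T al n x = w].
Proof.
apply/seteqP; split=> x /=.
  by move=> xw; apply/ffunP => i; rewrite ffunE; have := xw i Logic.I; rewrite /= Aal.
by move=> <- i _; rewrite /= Aal /= ffunE.
Qed.

Lemma measurable_join_atom n (w : {ffun 'I_n -> 'I_k}) : measurable (join_atom T A w).
Proof.
apply: fin_bigcap_measurable => // i _.
have mi : measurable_fun setT (iter i T).
  elim: (i : nat) => [|j IH]; first exact: measurable_id.
  by rewrite (_ : iter _ _ = T \o iter j T) //; exact: measurableT_comp.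
by rewrite -[X in measurable X]setTI; exact: mi.
Qed.

Lemma itinerary_indic n (g : {ffun 'I_n -> 'I_k} -> R) x :
  g (itinerary T al n x) = \sum_w g w * \1_(join_atom T A w) x.
Proof.
rewrite (bigD1 (itinerary T al n x)) //= big1 ?addr0.
  by rewrite join_atomE indicE mem_set // mulr1.
move=> w /eqP wN; rewrite indicE memNset ?mulr0 // join_atomE /=.
by move=> E; exact: wN.
Qed.

Lemma bounded_measurable_itinerary n (g : {ffun 'I_n -> 'I_k} -> R) :
  bounded_measurable (fun x => g (itinerary T al n x)).
Proof.
under eq_fun do rewrite itinerary_indic.
apply: bounded_measurable_sum => w; apply: bounded_measurableZ.
exact/bounded_measurable_indic/measurable_join_atom.
Qed.

Lemma expect_itinerary n (g : {ffun 'I_n -> 'I_k} -> R) :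
  expect (fun x => g (itinerary T al n x)) =
  \sum_w g w * fine (mu (join_atom T A w)).
Proof.
have bi w : bounded_measurable (\1_(join_atom T A w) : X -> R).
  exact/bounded_measurable_indic/measurable_join_atom.
under [in LHS]eq_fun do rewrite itinerary_indic.
rewrite expect_sum => [|w]; last exact: bounded_measurableZ.
apply: eq_bigr => w _; rewrite expectZ // expect_indic //.
exact: measurable_join_atom.
Qed.

Lemma sum_join_atom n :
  \sum_(w : {ffun 'I_n -> 'I_k}) fine (mu (join_atom T A w)) = 1.
Proof.
rewrite -[RHS](expect_cst 1) [RHS](expect_itinerary (n := n) (fun=> 1)).
by apply: eq_bigr => w _; rewrite mul1r.
Qed.

(* Gibbs' inequality: [ln y <= y - 1] applied to [Q w / mu (atom w)]. *)
Lemma join_entropy_le n (Q : {ffun 'I_n -> 'I_k} -> R) :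
  (forall w, 0 < Q w) -> \sum_w Q w <= 1 ->
  join_entropy T mu A n <= expect (fun x => - ln (Q (itinerary T al n x))).
Proof.
move=> Q0 Q1; rewrite (expect_itinerary (fun w => - ln (Q w))) /join_entropy.
rewrite -sumrN -subr_ge0 -sumrB.
apply: (@le_trans _ _ (\sum_w (fine (mu (join_atom T A w)) - Q w))).
  by rewrite sumrB sum_join_atom subr_ge0.
apply: ler_sum => w _; set m := fine _.
have : 0 <= m by exact: fine_ge0.
rewrite le_eqVlt => /predU1P[<-|m0].
  by rewrite mul0r mulr0 oppr0 subr0 sub0r oppr_le0 ltW.
have : ln (Q w / m) <= Q w / m - 1.
  have := @le_ln1Dx R (Q w / m - 1); rewrite addrCA subrr addr0; apply.
  by rewrite ltrBrDr addNr divr_gt0.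
rewrite ln_div ?posrE // => h.
have := ler_wpM2l (ltW m0) h.
rewrite !mulrBr mulrCA divff ?gt_eqF // !mulr1; lra.
Qed.

End itineraries.

End bounded_expectation.

(** * Grid functions *)

Lemma symbol_neq2 (a : symbol) : a != sym2 <-> a = sym1 \/ a = sym3.
Proof.
split; last by case=> ->.
by case: a => [[|[|[|//]]] i] // _; [left|right]; exact: val_inj.
Qed.

Lemma first_visitP n (x : Sigma3) : first_visit n x <->
  (forall i, (i < n)%N -> x i != sym2) /\ x n = sym2.
Proof.
by split=> -[h xn]; split=> // i /h; rewrite symbol_neq2.
Qed.

Lemma first_visit_exists n (x : Sigma3) : x n = sym2 ->
  exists2 m, (m <= n)%N & first_visit m x.
Proof.
move=> xn; have ex : exists m, x m == sym2 by exists n; rewrite xn.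
exists (ex_minn ex); case: ex_minnP => m /eqP xm mmin.
  by apply: mmin; rewrite xn.
apply/first_visitP; split=> // i im; apply/negP => /mmin.
by rewrite leqNgt im.
Qed.

Lemma first_visit_inj m n (x : Sigma3) : first_visit m x -> first_visit n x -> m = n.
Proof.
move=> /first_visitP[hm xm] /first_visitP[hn xn].
case: (ltngtP m n) => // [/hn|/hm]; first by rewrite xm.
by rewrite xn.
Qed.

Lemma first_visitS n (x : Sigma3) : first_visit n.+1 x -> first_visit n (shift x).
Proof.
by move=> /first_visitP[h xn]; apply/first_visitP; split=> // i /= ni; exact: h.
Qed.

(** The counter [i] is the age, the number of letters since the last 2. A letter 2 closes an
    excursion and collects [S] at its age; an unfinished last excursion contributes nothing. *)
Fixpoint excursion_sum (R : realType) (S : nat -> R) (i : nat) (u : seq symbol) : R :=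
  if u is b :: u' then
    if b == sym2 then S i + excursion_sum S 0 u' else excursion_sum S i.+1 u'
  else 0.

Lemma excursion_sum_no2 (R : realType) (S : nat -> R) i u :
  sym2 \notin u -> excursion_sum S i u = 0.
Proof.
elim: u i => //= b u IH i; rewrite inE negb_or eq_sym => /andP[/negbTE -> /IH]; exact.
Qed.

Lemma excursion_sum_visit (R : realType) (S : nat -> R) i n m (x : Sigma3) :
  first_visit n x ->
  excursion_sum S i (prefix (n.+1 + m) x) =
  S (i + n)%N + excursion_sum S 0 (prefix m (iter n.+1 shift x)).
Proof.
elim: n i x => [|n IH] i x /[dup] xv /first_visitP[h xn].
  by rewrite prefixS /= xn eqxx addn0.
rewrite addSn prefixS; move: (IH i.+1 _ (first_visitS xv)).
move: (prefix (n.+1 + m) (shift x)) => u E.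
by rewrite /= (negbTE (h 0%N _)) // E addSnnS -iterSr.
Qed.

Section grid.
Context {R : realType} (a : nat -> R).
Local Notation phi := (grid_function a).

Local Notation grid_series x := (series (fun n => a n * \1_(first_visit n) x)).

Lemma grid_series_visit n x : first_visit n x -> \forall N \near \oo, grid_series x N = a n.
Proof.
move=> xn; near=> N; rewrite /series /= (@big_cat_nat _ _ _ n.+1) //=; last first.
  by near: N; exact: nbhs_infty_ge.
rewrite big_nat_recr //= indicE mem_set // mulr1.
rewrite !big_nat !big1 ?add0r ?addr0 // => i.
  by move=> h; rewrite indicE memNset ?mulr0 // => /(first_visit_inj xn) E; lia.
by move=> h; rewrite indicE memNset ?mulr0 // => /(first_visit_inj xn) E; lia.
Unshelve. all: by end_near. Qed.

Lemma grid_series_no2 (x : Sigma3) : (forall n, x n != sym2) ->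
  \forall N \near \oo, grid_series x N = 0.
Proof.
move=> xn; near=> N; rewrite /series /= big1 // => i _.
by rewrite indicE memNset ?mulr0 // => -[_ xi]; have := xn i; rewrite xi.
Unshelve. all: by end_near. Qed.

Lemma grid_function_visit n x : first_visit n x -> phi x = a n.
Proof. by move=> /grid_series_visit; exact: lim_near_cst. Qed.

Lemma grid_function_no2 (x : Sigma3) : (forall n, x n != sym2) -> phi x = 0.
Proof. by move=> /grid_series_no2; exact: lim_near_cst. Qed.

Lemma visit_or_no2 (x : Sigma3) :
  (exists n, first_visit n x) \/ (forall n, x n != sym2).
Proof.
have [[n xn]|xN] := pselect (exists n, x n = sym2).
  by left; have [k _ xk] := first_visit_exists xn; exists k.
by right=> n; apply/eqP => xn; apply: xN; exists n.
Qed.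

Lemma grid_series_cvg (x : Sigma3) : grid_series x n @[n --> \oo] --> phi x.
Proof.
apply: cvg_near_cst; case: (visit_or_no2 x) => [[n xn]|xn].
  by rewrite (grid_function_visit xn); exact: grid_series_visit.
by rewrite (grid_function_no2 xn); exact: grid_series_no2.
Qed.

Lemma grid_function_far m d (x : Sigma3) : 0 <= d -> (forall j, (m <= j)%N -> `|a j| <= d) ->
  (forall i, (i < m)%N -> x i != sym2) -> `|phi x| <= d.
Proof.
move=> d0 ad xm; case: (visit_or_no2 x) => [[k xk]|xN]; last first.
  by rewrite grid_function_no2 ?normr0.
rewrite (grid_function_visit xk) ad //.
by rewrite leqNgt; apply/negP => /xm; rewrite xk.2.
Qed.

Definition birkhoff (n : nat) (x : Sigma3) : R := \sum_(k < n) phi (iter k shift x).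

Lemma birkhoffD m n x : birkhoff (m + n) x = birkhoff m x + birkhoff n (iter m shift x).
Proof.
rewrite /birkhoff big_split_ord /=; congr (_ + _).
by apply: eq_bigr => i _; rewrite -iterD addnC.
Qed.

Lemma birkhoffS n x : birkhoff n.+1 x = phi x + birkhoff n (shift x).
Proof. by rewrite -add1n birkhoffD /birkhoff big_ord1. Qed.

Lemma birkhoff_visit n x : first_visit n x -> birkhoff n.+1 x = \sum_(k < n.+1) a k.
Proof.
elim: n x => [|n IH] x xn.
  by rewrite /birkhoff !big_ord1 (grid_function_visit xn).
by rewrite birkhoffS (IH _ (first_visitS xn)) (grid_function_visit xn) addrC [RHS]big_ord_recr.
Qed.

Hypothesis a0 : a n @[n --> \oo] --> (0 : R).

Lemma grid_bounded : exists2 K : R, 0 <= K & forall n, `|a n| <= K.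
Proof.
have /cvg_seq_bounded[M [_ aM]] : cvgn a by apply/cvg_ex; exists 0.
exists `|M + 1| => // n; rewrite (le_trans _ (ler_norm _)) //.
by apply: aM; rewrite // ltrDl.
Qed.

(* Before the first visit to [2] the potential is evaluated at indices at
   least as large as the number of remaining letters. *)
Lemma birkhoff_no2 (d : R) : 0 < d -> exists2 C, 0 <= C &
  forall m (x : Sigma3), (forall i, (i < m)%N -> x i != sym2) -> `|birkhoff m x| <= d * m%:R + C.
Proof.
move=> d0; have [K K0 aK] := grid_bounded.
have /cvgrPdist_le /(_ _ d0) [J _ aJ] := a0.
suff H m (x : Sigma3) : (forall i, (i < m)%N -> x i != sym2) ->
    `|birkhoff m x| <= d * m%:R + K * (minn m J)%:R.
  exists (K * J%:R) => [|m x /H]; first by rewrite mulr_ge0.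
  by move/le_trans; apply; rewrite lerD2l ler_wpM2l // ler_nat geq_minr.
elim: m x => [|m IH] x xm; first by rewrite /birkhoff big_ord0 normr0 mulr0 add0r mulr_ge0.
rewrite birkhoffS; apply: le_trans (ler_normD _ _) _.
have {}IH := IH (shift x) (fun i => xm i.+1).
have [mJ|Jm] : (m.+1 < J)%N \/ (J <= m.+1)%N by lia.
  have h : `|phi x| <= K by exact: (@grid_function_far m.+1).
  rewrite (minn_idPl (ltnW mJ)); rewrite (minn_idPl (ltnW (ltnW mJ))) in IH.
  rewrite -natr1; nra.
have h : `|phi x| <= d.
  apply: (@grid_function_far m.+1) => // [|j mj]; first exact: ltW.
  by have := aJ j (leq_trans Jm mj); rewrite sub0r normrN.
have : K * (minn m J)%:R <= K * (minn m.+1 J)%:R.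
  by rewrite ler_wpM2l // ler_nat leq_min geq_minr (leq_trans (geq_minl _ _)).
rewrite -natr1; lra.
Qed.

(** Both sums agree on every completed excursion. They differ only on the final stretch without 2,
    where [birkhoff_no2] applies; its length is at most [m]. *)
Lemma birkhoff_excursion_sum (d : R) : 0 < d -> exists2 C, 0 <= C & forall m x,
  `|birkhoff m x - excursion_sum (fun n => \sum_(k < n.+1) a k) 0 (prefix m x)|
    <= d * m%:R + C.
Proof.
move=> /[dup] d0 /birkhoff_no2[C C0 HC]; exists C => // m; move: {2}m.+1 (ltnSn m) => M.
elim: M m => // M IH m mM x.
have [[n nm xn]|xN] := pselect (exists2 n, (n < m)%N & x n = sym2); last first.
  have xm i : (i < m)%N -> x i != sym2 by move=> im; apply/eqP => xi; apply: xN; exists i.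
  rewrite excursion_sum_no2 ?subr0; first exact: HC.
  by apply/mapP => -[i]; rewrite mem_iota => /xm /eqP /[swap] /esym.
have [k kn xk] := first_visit_exists xn.
have km : (k.+1 <= m)%N by exact: leq_ltn_trans nm.
rewrite -(subnKC km) excursion_sum_visit // birkhoffD birkhoff_visit //.
rewrite add0n opprD addrACA subrr add0r.
apply: (le_trans (IH _ _ _)); first by lia.
by rewrite lerD2r ler_pM2l // ler_nat (subnKC km) leq_subr.
Qed.

Lemma measurable_first_visit n : measurable (first_visit n : set borel_Sigma3).
Proof.
rewrite (_ : first_visit n =
  (\bigcap_(i in `I_n) ~` [set x | x i = sym2]) `&` [set x | x n = sym2]).
  apply: measurableI; last exact: measurable_coord.
  by apply: bigcap_measurableType => i _; apply: measurableC; exact: measurable_coord.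
apply/seteqP; split=> x.
  by move=> /first_visitP[h xn]; split=> // i /h /eqP.
by move=> [h xn]; apply/first_visitP; split=> // i /h /eqP.
Qed.

Lemma bounded_measurable_grid : bounded_measurable (phi : borel_Sigma3 -> R).
Proof.
split; last first.
  have [K K0 aK] := grid_bounded; exists K => x.
  by apply: (@grid_function_far 0).
apply: (@measurable_fun_cvg _ borel_Sigma3 _ _
    (fun n x => series (fun k => a k * \1_(first_visit k) x) n)).
  move=> n; rewrite /series /=; apply: measurable_sum => k.
  by apply: measurable_funM => //; apply: measurable_indic; exact: measurable_first_visit.
by move=> x _; exact: grid_series_cvg.
Qed.

Lemma bounded_measurable_birkhoff n : bounded_measurable (birkhoff n : borel_Sigma3 -> R).
Proof.
elim: n => [|n IH].
  rewrite (_ : birkhoff 0 = cst 0); first exact: bounded_measurable_cst.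
  by apply/funext => x; rewrite /birkhoff big_ord0.
rewrite (_ : birkhoff n.+1 = fun x => phi x + (birkhoff n \o shift) x).
  apply: bounded_measurableD; first exact: bounded_measurable_grid.
  by apply: bounded_measurable_comp => //; exact: measurable_shift.
by apply/funext => x; rewrite birkhoffS.
Qed.

Lemma expect_birkhoff (mu : probability borel_Sigma3 R) n :
  invariant_measure bshift mu ->
  expect mu (birkhoff n) = n%:R * expect mu phi.
Proof.
move=> inv; elim: n => [|n IH].
  rewrite mul0r -[RHS](expect_cst mu 0); congr expect.
  by apply/funext => x; rewrite /birkhoff big_ord0.
rewrite (_ : birkhoff n.+1 = fun x => phi x + (birkhoff n \o shift) x); last first.
  by apply/funext => x; rewrite birkhoffS.
have bs := bounded_measurable_comp measurable_shift (bounded_measurable_birkhoff n).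
rewrite expectD //; last exact: bounded_measurable_grid.
rewrite (expect_invariant measurable_shift inv (bounded_measurable_birkhoff n)) IH.
by rewrite -natr1 mulrDl mul1r addrC.
Qed.

End grid.

(** * Weights of words *)

Section word_total.
Context {R : realType}.
Implicit Types f g : seq symbol -> R.

(** Peeling off the first letter, instead of summing over tuples, matches the recursion of
    [excursion_sum]. *)
Fixpoint word_total (m : nat) f : R :=
  if m is m'.+1 then \sum_(b : symbol) word_total m' (fun u => f (b :: u)) else f [::].

Lemma word_total_le m f g : (forall u, f u <= g u) -> word_total m f <= word_total m g.
Proof. by elim: m f g => [|m IH] f g fg /=; [exact: fg|apply: ler_sum => b _; exact: IH]. Qed.

Lemma word_totalZ m c f : word_total m (fun u => c * f u) = c * word_total m f.
Proof. by elim: m f => [|m IH] f //=; rewrite big_distrr; apply: eq_bigr => b _; rewrite IH. Qed.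

Lemma word_total_sum (I : finType) m (F : I -> seq symbol -> R) :
  \sum_i word_total m (F i) = word_total m (fun u => \sum_i F i u).
Proof.
elim: m F => [|m IH] F //=; rewrite exchange_big; apply: eq_bigr => b _.
by rewrite IH.
Qed.

Lemma word_total_ge0 m f : (forall u, 0 <= f u) -> 0 <= word_total m f.
Proof. by elim: m f => [|m IH] f f0 //=; apply: sumr_ge0 => b _; exact: IH. Qed.

Lemma word_total_ge m f (x : Sigma3) : (forall u, 0 <= f u) -> f (prefix m x) <= word_total m f.
Proof.
elim: m f x => [|m IH] f x f0 //=.
rewrite prefixS (bigD1 (x 0%N)) //=.
apply: le_trans (IH (fun u => f (x 0%N :: u)) (shift x) (fun u => f0 _)) _.
by rewrite lerDl sumr_ge0 // => b _; exact: word_total_ge0.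
Qed.

Lemma sum_symbol (F : symbol -> R) : \sum_b F b = F sym1 + F sym2 + F sym3.
Proof.
rewrite [LHS]big_ord_recl [X in _ + X]big_ord_recl [X in _ + (_ + X)]big_ord_recl big_ord0 addr0 addrA.
by congr (_ + _ + _); apply: (congr1 F); apply: val_inj.
Qed.

End word_total.

Section partition_function.
Context {R : realType} (S : nat -> R) (q : R).
Hypothesis q0 : 0 <= q.
Hypothesis Sq : forall N, \sum_(n < N) expR (S n - n.+1%:R * q) <= 2.

Let Z i m := word_total m (fun u => expR (excursion_sum S i u)).

Let ZS i m : Z i m.+1 = expR (S i) * Z 0 m + 2 * Z i.+1 m.
Proof.
rewrite /Z /= sum_symbol /=.
have -> : expR (S i) * word_total m (fun u => expR (excursion_sum S 0 u)) =
    word_total m (fun u => expR (S i + excursion_sum S 0 u)).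
  by rewrite -word_totalZ; congr word_total; apply/funext => u; rewrite expRD.
ring.
Qed.

(** Renewal equation: [j] letters different from 2 precede the first 2, and the last term counts the
    words without any 2. *)
Let ZE i m : Z i m =
  \sum_(j < m) 2 ^+ j * expR (S (i + j)) * Z 0 (m - j.+1) + 2 ^+ m.
Proof.
elim: m i => [|m IH] i; first by rewrite big_ord0 add0r expr0 /Z /= expR0.
rewrite ZS (IH i.+1) big_ord_recl /= expr0 mul1r addn0 subn1 /= -addrA; congr (_ + _).
rewrite mulrDr. rewrite exprS big_distrr /=; congr (_ + _); apply: eq_bigr => j _.
by rewrite /bump /= add1n exprS !mulrA addSnnS subSS.
Qed.

(** Induction along the renewal equation. The words without 2 add a further [2 ^+ m] at each stage,
    so a constant factor would not survive the induction; the factor [m.+1] absorbs this term and is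
    subexponential. *)
Lemma word_total_excursion_le m :
  word_total m (fun u => expR (excursion_sum S 0 u)) <=
  m.+1%:R * (2 ^+ m * expR (m%:R * q)).
Proof.
rewrite -/(Z 0 m); elim/ltn_ind: m => m IH.
have e1 : 1 <= expR (m%:R * q) by rewrite -expR0 ler_expR mulr_ge0.
have p2 k : 0 < 2 ^+ k :> R by rewrite exprn_gt0.
rewrite ZE -[m.+1%:R]natr1 mulrDl mul1r; apply: lerD; last by rewrite ler_peMr // ltW.
apply: (@le_trans _ _ (m%:R * (2 ^+ m * expR (m%:R * q)) / 2 *
    \sum_(n < m) expR (S n - n.+1%:R * q))); last first.
  by rewrite -[leRHS](divfK (_ : 2 != 0)) // ler_wpM2l // !mulr_ge0 // ?expR_ge0 // ltW.
rewrite big_distrr /=; apply: ler_sum => j _; rewrite add0n.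
apply: (@le_trans _ _ (2 ^+ j * expR (S j) *
    (m%:R * (2 ^+ (m - j.+1) * expR ((m - j.+1)%:R * q))))).
  apply: ler_wpM2l; first by rewrite mulr_ge0 ?expR_ge0 ?ltW.
  apply: le_trans (IH (m - j.+1)%N _) _; first by have := ltn_ord j; lia.
  apply: ler_wpM2r; first by rewrite mulr_ge0 ?expR_ge0 ?ltW.
  rewrite ler_nat; have := ltn_ord j; lia.
move: (nat_of_ord j) (ltn_ord j) => i im.
rewrite expRB; have -> : expR (m%:R * q) = expR ((m - i.+1)%:R * q) * expR (i.+1%:R * q).
  by rewrite -expRD -mulrDl -natrD subnK.
have -> : 2 ^+ m = 2 ^+ i * 2 ^+ (m - i.+1) * 2 :> R by rewrite -exprD -exprSr; congr (_ ^+ _); lia.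
have eN0 : expR (i.+1%:R * q) != 0 by rewrite gt_eqF ?expR_gt0.
by rewrite le_eqVlt; apply/orP; left; apply/eqP; field.
Qed.

End partition_function.

(** * Upper bound for the entropy *)

Section upper_bound.
Context {R : realType}.

Lemma ln_prod (I : finType) (F : I -> R) : (forall i, 0 < F i) ->
  ln (\prod_i F i) = \sum_i ln (F i).
Proof.
move=> F0; have [] : 0 < \prod_i F i /\ ln (\prod_i F i) = \sum_i ln (F i); last by [].
apply: (big_rec2 (fun x y => 0 < x /\ ln x = y)); first by rewrite ln1.
by move=> i y x _ [x0 <-]; rewrite mulr_gt0 // lnM ?posrE.
Qed.

Lemma label_approx (mu : probability borel_Sigma3 R) k (al : borel_Sigma3 -> 'I_k) (e : R) :
  (forall j, measurable [set x | al x = j]) -> 0 < e ->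
  exists N (c : seq symbol -> 'I_k),
    let E := [set x | al x != c (prefix N x)] in
    measurable E /\ fine (mu E) <= e.
Proof.
move=> mal e0; pose j0 := al point.
have k0 : (0 < k)%N by case: (k) j0 => [[]|].
(* Each of the [k] labels is allowed an error [e / k]. *)
have ek0 : 0 < e / k%:R by rewrite divr_gt0 // ltr0n.
have ch (j : 'I_k) : {Nc : nat * (seq symbol -> bool) | (mu (([set x | al x = j] `\` cylset Nc.1 Nc.2) `|`
    (cylset Nc.1 Nc.2 `\` [set x | al x = j])) < (e / k%:R)%:E)%E}.
  apply: cid; have [_ /(_ _ ek0)[N [c h]]] := measurable_approximable mu (mal j).
  by exists (N, c).
pose Nj j := (sval (ch j)).1; pose cj j := (sval (ch j)).2.
pose N := (\max_j Nj j)%N.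
(* If the chosen label [j] is wrong, the point lies in the test set of [j] but not in its atom; if
   no test succeeds, the point lies in its atom but not in the test set. Either way it is in one of
   the symmetric differences. *)
pose c u := odflt j0 [pick j | cj j (take (Nj j) u)].
exists N, c => E.
have mE : measurable E.
  rewrite (_ : E = ~` \bigcup_j ([set x | al x = j] `&` cylset N (fun u => c u == j))).
    apply: measurableC; apply: fin_bigcup_measurable => // j _.
    by apply: measurableI => //; exact: measurable_cylset.
  apply/seteqP; split=> x /=.
    by move=> /eqP xN [j _ [/= xj /eqP cj']]; apply: xN; rewrite xj -cj'.
  move=> xN; apply/eqP => xc; apply: xN; exists (al x) => //.
  by split => //; rewrite /cylset /= xc.
split=> //.
pose D j := ([set x | al x = j] `\` cylset (Nj j) (cj j)) `|` (cylset (Nj j) (cj j) `\` [set x | al x = j]).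
have mD j : measurable (D j).
  have := measurable_cylset (Nj j) (cj j).
  by move=> mc; apply: measurableU; exact: measurableD.
rewrite -expect_indic //; apply: (@le_trans _ _ (expect mu (fun x => \sum_j \1_(D j) x))).
  apply: expect_le; first exact: bounded_measurable_indic.
    by apply: bounded_measurable_sum => j; exact: bounded_measurable_indic.
  move=> x; have [xE|xE] := pselect (E x); last first.
    by rewrite indicE memNset //; apply: sumr_ge0 => j _; rewrite indicE.
  rewrite indicE mem_set //; suff [j xD] : exists j, D j x.
    rewrite (bigD1 j) //= indicE mem_set // lerDl; apply: sumr_ge0 => i _.
    by rewrite indicE.
  apply: contrapT => nD; move: (xE); rewrite /E /= /c.
  have tk j : take (Nj j) (prefix N x) = prefix (Nj j) x by rewrite take_prefix // leq_bigmax.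
  case: pickP => [j|/(_ (al x))] /=; rewrite tk => cj'.
    by move/eqP => xj; apply: nD; exists j; right; split.
  by move=> _; apply: nD; exists (al x); left; split => //; rewrite /cylset /= cj'.
rewrite expect_sum => [|j]; last exact: bounded_measurable_indic.
apply: (@le_trans _ _ (\sum_(j < k) e / k%:R)).
  apply: ler_sum => j _; rewrite expect_indic // -lee_fin fineK; last exact: fin_num_measure.
  by apply/ltW; have := svalP (ch j).
by rewrite sumr_const card_ord -[X in X <= _]mulr_natr divfK // pnatr_eq0 -lt0n.
Qed.

Section fixed_measure.
Variables (a : nat -> R) (q : R).
Hypotheses (a0 : a n @[n --> \oo] --> (0 : R)) (q0 : 0 <= q).
Let S n : R := \sum_(k < n.+1) a k.
Hypothesis Sq : forall N, \sum_(n < N) expR (S n - n.+1%:R * q) <= 2.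
Variable mu : probability borel_Sigma3 R.
Hypothesis inv : invariant_measure bshift mu.

Lemma ln_nat_le (d : R) (m : nat) : 0 < d -> ln (m.+1%:R) <= d * m%:R + (d - ln d).
Proof.
move=> d0; have := @le_ln1Dx R (d * m.+1%:R - 1); rewrite addrCA subrr addr0.
have dm : 0 < d * m.+1%:R by rewrite mulr_gt0.
have dm1 : -1 < d * m.+1%:R - 1 by rewrite ltrBrDr addNr.
move=> /(_ dm1).
rewrite lnM ?posrE // -natr1; lra.
Qed.

(** Normalised by the bound of [word_total_excursion_le] instead of the true total, which keeps its
    logarithm explicit. *)
Definition word_weight m u := expR (excursion_sum S 0 u) / (m.+1%:R * (2 ^+ m * expR (m%:R * q))).

Lemma word_weight_gt0 m u : 0 < word_weight m u.
Proof. by rewrite divr_gt0 ?expR_gt0 // !mulr_gt0 ?exprn_gt0 ?expR_gt0. Qed.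

Lemma word_weight_total m : word_total m (word_weight m) <= 1.
Proof.
rewrite (_ : word_weight m = fun u => (m.+1%:R * (2 ^+ m * expR (m%:R * q)))^-1 * expR (excursion_sum S 0 u)).
  rewrite word_totalZ mulrC ler_pdivrMr ?mul1r; last by rewrite !mulr_gt0 ?exprn_gt0 ?expR_gt0.
  exact: word_total_excursion_le.
by apply/funext => u; rewrite mulrC.
Qed.

Lemma ln_word_weight (d : R) : 0 < d -> exists C, forall m x,
  - ln (word_weight m (prefix m x)) <= m%:R * (ln 2 + q + d) + C - birkhoff a m x.
Proof.
(* One half of [d] pays for the unfinished excursion, the other for the logarithm of the factor
   [m.+1]. *)
move=> d0; have d20 : 0 < d / 2 by rewrite divr_gt0.
have [C C0 HC] := birkhoff_excursion_sum a0 d20.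
exists (C + (d / 2 - ln (d / 2))) => m x.
have := HC m x; have := ln_nat_le m d20.
have -> : ln (word_weight m (prefix m x)) =
    excursion_sum S 0 (prefix m x) - (ln m.+1%:R + (m%:R * ln 2 + m%:R * q)).
  rewrite /word_weight ln_div ?posrE ?expR_gt0 //; last by rewrite !mulr_gt0 ?exprn_gt0 ?expR_gt0.
  rewrite !lnM ?posrE ?mulr_gt0 ?exprn_gt0 ?expR_gt0 // !expRK lnXn // -[ln 2 *+ m]mulr_natl.
  by [].
rewrite ler_norml -/S => h1 /andP[h2 h3]; lra.
Qed.

Lemma join_entropy_upper k (A : 'I_k -> set borel_Sigma3) (e : R) :
  measurable_partition A -> 0 < e -> exists C, forall n,
  join_entropy bshift mu A n <= n%:R * (ln 2 + q - expect mu (grid_function a) + e) + C.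
Proof.
move=> pA e0; have [mA _ _] := pA; have [al Aal] := partition_label pA.
have e40 : 0 < e / 4 by rewrite divr_gt0.
have k0 : (0 < k)%N by case: (k) (al point) => [[]|].
have kR0 : 0 < k%:R :> R by rewrite ltr0n.
(* Chosen so that a label read correctly costs [- ln (1 - dl)], that is [e / 4]; a misread label
   costs [L]. *)
pose dl := 1 - expR (- (e / 4)).
have dl1 : dl < 1 by rewrite ltrBlDr ltrDl expR_gt0.
have dl0 : 0 < dl by rewrite subr_gt0 expR_lt1 oppr_lt0.
have l1dl : ln (1 - dl) = - (e / 4) by rewrite subKr expRK.
pose L := - ln (dl / k%:R).
have dlk0 : 0 < dl / k%:R by rewrite divr_gt0.
have dlk1 : dl / k%:R <= 1.
  by rewrite ler_pdivrMr // mul1r (le_trans (ltW dl1)) // ler1n.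
have L0 : 0 <= L by rewrite oppr_ge0 ln_le0.
(* Misreadings of frequency at most [ep] cost on average [L * ep], which stays below [e / 4]. *)
pose ep := e / 4 / (L + 1).
have ep0 : 0 < ep by rewrite divr_gt0 // ltr_wpDl.
have mal j : measurable [set x | al x = j] by rewrite -Aal.
have [N [c]] := label_approx mu mal ep0.
set E := [set x | _] => -[mE muE].
(* The noisy channel: it gives every output positive probability, so an approximate label that is
   wrong costs a finite amount. The rows sum to at most 1. *)
pose kap (j j' : 'I_k) := if j' == j then 1 - dl else dl / k%:R.
have kap0 j j' : 0 < kap j j' by rewrite /kap; case: ifP => _ //; rewrite subr_gt0.
have kap1 j : \sum_j' kap j j' <= 1.
  rewrite (bigD1 j) //= {1}/kap eqxx.
  rewrite (eq_bigr (fun=> dl / k%:R)) => [|i /negbTE ij]; last by rewrite /kap ij.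
  apply: (@le_trans _ _ (1 - dl + \sum_(i < k) dl / k%:R)).
    rewrite lerD2l [leRHS](bigD1 j) //= lerDr; exact: ltW.
  by rewrite sumr_const card_ord -[_ *+ k]mulr_natr divfK ?gt_eqF // subrK.
(* The label at time [i < n] is guessed from the letters [i] to [i + N - 1], hence words of [n + N]
   letters. *)
pose Q n (w : {ffun 'I_n -> 'I_k}) := word_total (n + N) (fun u => word_weight (n + N) u *
  \prod_(i < n) kap (c (take N (drop i u))) (w i)).
have prod0 n (w : {ffun 'I_n -> 'I_k}) u : 0 < \prod_(i < n) kap (c (take N (drop i u))) (w i).
  by apply: prodr_gt0.
have Qge n (w : {ffun 'I_n -> 'I_k}) x : word_weight (n + N) (prefix (n + N) x) *
    \prod_(i < n) kap (c (prefix N (iter i shift x))) (w i) <= Q n w.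
  apply: le_trans (word_total_ge (n + N) x _); last first.
    by move=> u; rewrite mulr_ge0 ?ltW ?word_weight_gt0.
  apply: ler_wpM2l; first exact/ltW/word_weight_gt0.
  rewrite le_eqVlt; apply/orP; left; apply/eqP; apply: eq_bigr => i _; congr (kap (c _) _).
  have -> : (n + N = i + (n - i + N))%N by rewrite addnA subnKC // ltnW.
  by rewrite drop_prefix take_prefix // leq_addl.
have Q0 n w : 0 < Q n w.
  by apply: lt_le_trans (Qge n w point); rewrite mulr_gt0 ?word_weight_gt0 // prodr_gt0.
(* For a fixed word the outputs at different times are independent, so the sum over [w] is a product
   of row sums. *)
have Q1 n : \sum_w Q n w <= 1.
  rewrite word_total_sum; apply: le_trans (word_weight_total (n + N)).
  apply: word_total_le => u; rewrite -big_distrr /=; apply: ler_piMr; first exact/ltW/word_weight_gt0.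
  have -> : \sum_(w : {ffun 'I_n -> 'I_k}) \prod_(i < n) kap (c (take N (drop i u))) (w i) =
      \prod_(i < n) \sum_j kap (c (take N (drop i u))) j by rewrite bigA_distr_bigA.
  by apply: Num.Theory.prodr_ile1 => i _; rewrite kap1 andbT sumr_ge0 // => j _; exact: ltW.
have [C HC] := ln_word_weight e40.
exists (N%:R * (ln 2 + q + e / 4 - expect mu (grid_function a)) + C) => n.
apply: le_trans (join_entropy_le mu measurable_shift mA Aal (Q0 n) (Q1 n)) _.
have bB : bounded_measurable (birkhoff a (n + N) : borel_Sigma3 -> R) by exact: bounded_measurable_birkhoff.
have bE : bounded_measurable (\1_E : borel_Sigma3 -> R) by exact: bounded_measurable_indic.
have mit i : measurable_fun setT (iter i bshift).
  elim: i => [|i IH]; first exact: measurable_id.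
  by rewrite (_ : iter _ _ = shift \o iter i shift) //; exact: measurableT_comp measurable_shift IH.
pose G i (x : borel_Sigma3) := L * (\1_E \o iter i shift) x + e / 4.
have bG i : bounded_measurable (G i).
  apply: bounded_measurableD; last exact: bounded_measurable_cst.
  by apply: bounded_measurableZ; exact: bounded_measurable_comp.
have kapG x i : - ln (kap (c (prefix N (iter i shift x))) (al (iter i shift x))) <= G i x.
  rewrite /G /kap /= indicE; case: eqP => /= [xc|/eqP xc].
    by rewrite l1dl opprK lerDr mulr_ge0.
  by rewrite mem_set // mulr1 lerDl ltW.
have ptw (x : borel_Sigma3) : - ln (Q n (itinerary bshift al n x)) <=
    ((n + N)%:R * (ln 2 + q + e / 4) + C) + (- 1 * birkhoff a (n + N) x + \sum_(i < n) G i x).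
  have := Qge n (itinerary bshift al n x) x.
  set pr := \prod_(i < n) _ => h; have pr0 : 0 < pr by exact: prodr_gt0.
  have wpr0 : 0 < word_weight (n + N) (prefix (n + N) x) * pr by rewrite mulr_gt0 ?word_weight_gt0.
  have := HC (n + N)%N x; rewrite mulN1r => h1.
  have : ln (word_weight (n + N) (prefix (n + N) x) * pr) <= ln (Q n (itinerary bshift al n x)).
    by rewrite ler_ln ?posrE.
  rewrite lnM ?posrE ?word_weight_gt0 // => h2.
  have h3 : - ln pr <= \sum_(i < n) G i x.
    rewrite ln_prod // -sumrN; apply: ler_sum => i _; rewrite ffunE; exact: kapG.
  lra.
have bS : bounded_measurable (fun x => \sum_(i < n) G i x) by exact: bounded_measurable_sum.
have bB1 := bounded_measurableZ (- 1) bB.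
apply: le_trans (expect_le mu _ _ ptw) _.
- exact: (bounded_measurable_itinerary measurable_shift mA Aal (fun w => - ln (Q n w))).
- by apply: bounded_measurableD; [exact: bounded_measurable_cst|exact: bounded_measurableD].
rewrite (expectD mu (f := cst _)) ?expect_cst //; [|exact: bounded_measurable_cst|exact: bounded_measurableD].
rewrite expectD // expectZ // expect_birkhoff // expect_sum //.
(* By invariance the approximate label is wrong with the same probability at every time [i]. *)
have EG i : expect mu (G i) <= e / 2.
  rewrite (expectD mu (g := cst _)); [|exact/bounded_measurableZ/bounded_measurable_comp|exact: bounded_measurable_cst].
  rewrite expect_cst expectZ; last exact: bounded_measurable_comp.
  have -> : expect mu (\1_E \o iter i shift) = fine (mu E).
    rewrite -expect_indic //; apply: expect_invariant => //.
    elim: i => [|i IH] B mB; first by [].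
    rewrite (_ : iter i.+1 shift @^-1` B = shift @^-1` (iter i shift @^-1` B)).
      rewrite inv; first exact: IH.
      by rewrite -[X in measurable X]setTI; exact: mit.
    by apply/seteqP; split=> x; rewrite /= -iterSr.
  have -> : e / 2 = (L + 1) * ep + e / 4.
    by rewrite /ep; field; rewrite gt_eqF // ltr_wpDl.
  by rewrite lerD2r; apply: ler_pM => //; [exact: fine_ge0|rewrite lerDl].
have : \sum_(i < n) expect mu (G i) <= n%:R * (e / 2).
  apply: (@le_trans _ _ (\sum_(i < n) e / 2)); first exact: ler_sum.
  by rewrite sumr_const card_ord -[_ *+ n]mulr_natl.
rewrite natrD; have : 0 <= n%:R :> R by [].
move=> nn0; have := mulr_ge0 nn0 (ltW e0).
set X := \sum_(i < n) _; set Y := expect mu _; clearbody X Y.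
clear -nn0; move: nn0; move: (n%:R : R) (N%:R : R) => nn NN nn0 h1 h2.
rewrite -[X in X + _ <= _]/((nn + NN) * (ln 2 + q + e / 4) + C); lra.
Qed.

End fixed_measure.
End upper_bound.

(** * Upper bound for the pressure *)

Section limits_of_averages.
Context {R : realType}.

Lemma near_le_natM (C d : R) : 0 < d -> \forall n \near \oo, C <= d * n%:R.
Proof.
move=> d0; near=> n; rewrite mulrC -ler_pdivrMr //.
by near: n; exact: nbhs_infty_ger.
Unshelve. all: by end_near. Qed.

Lemma limn_average_le (H : nat -> R) (v : R) : (forall n, 0 <= H n) ->
  (forall e, 0 < e -> exists C, forall n, H n <= n%:R * (v + e) + C) ->
  limn (fun n => H n / n%:R) <= v.
Proof.
move=> H0 Hv.
have avg e : 0 < e -> \forall n \near \oo, H n / n%:R <= v + e.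
  move=> e0; have e20 : 0 < e / 2 by rewrite divr_gt0.
  have [C HC] := Hv _ e20; near=> n.
  have n0 : 0 < n%:R :> R by rewrite ltr0n; near: n; exact: nbhs_infty_gt.
  rewrite ler_pdivrMr //; apply: le_trans (HC n) _.
  have : C <= e / 2 * n%:R by near: n; exact: near_le_natM.
  nra.
(* Convergence is not known here: a divergent sequence has the default limit 0, which the
   nonnegative averages dominate. *)
have [cH|/dvgP->] := pselect (cvgn (fun n => H n / n%:R)).
  by apply/ler_addgt0Pr => e /avg; exact: limr_le.
apply/ler_addgt0Pr => e /avg [n _ /(_ n (leqnn n))] /=; apply: le_trans.
by rewrite divr_ge0.
Unshelve. all: by end_near. Qed.

Lemma cvg_average (H : nat -> R) (v : R) :
  (forall e, 0 < e -> exists C, forall n, `|H n - n%:R * v| <= n%:R * e + C) ->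
  H n / n%:R @[n --> \oo] --> v.
Proof.
move=> Hv; apply/cvgrPdist_le => e e0.
have e20 : 0 < e / 2 by rewrite divr_gt0.
have [C HC] := Hv _ e20; near=> n.
have n0 : 0 < n%:R :> R by rewrite ltr0n; near: n; exact: nbhs_infty_gt.
have -> : v - H n / n%:R = - (H n - n%:R * v) / n%:R by field; rewrite gt_eqF.
rewrite normrM normrN [ `|n%:R^-1|]gtr0_norm ?invr_gt0 // ler_pdivrMr //.
apply: le_trans (HC n) _.
have : C <= e / 2 * n%:R by near: n; exact: near_le_natM.
nra.
Unshelve. all: by end_near. Qed.

End limits_of_averages.

Section pressure_upper.
Context {R : realType}.

Lemma join_entropy_ge0 d (X : measurableType d) (f : X -> X) (mu : probability X R)
    k (A : 'I_k -> set X) n : measurable_fun setT f -> measurable_partition A ->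
  0 <= join_entropy f mu A n.
Proof.
move=> mf pA; have [mA _ _] := pA; have [al Aal] := partition_label pA.
rewrite /join_entropy oppr_ge0; apply: sumr_le0 => w _.
have mB := measurable_join_atom mf mA w.
apply: mulr_ge0_le0; first exact: fine_ge0.
apply: ln_le0; rewrite -lee_fin fineK; last exact: fin_num_measure.
exact: probability_le1.
Qed.

Lemma integral_expect d (X : measurableType d) (mu : probability X R) (f : X -> R) :
  bounded_measurable f -> (\int[mu]_x (f x)%:E)%E = (expect mu f)%:E.
Proof.
move=> bf; rewrite /expect /Rintegral fineK //.
exact: integrable_fin_num (bounded_measurable_integrable mu bf).
Qed.

Lemma pressure_le (a : nat -> R) (q : R) : a n @[n --> \oo] --> (0 : R) -> 0 <= q ->
  (forall N, \sum_(n < N) expR (\sum_(k < n.+1) a k - n.+1%:R * q) <= 2) ->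
  (pressure bshift (grid_function a) <= (ln 2 + q)%:E)%E.
Proof.
move=> a0 q0 Sq; apply: ge_ereal_sup => _ [mu [inv _ ->]].
rewrite integral_expect; last exact: bounded_measurable_grid.
rewrite -leeBrDr // -EFinB; apply: ge_ereal_sup => _ [k [A [pA ->]]].
rewrite lee_fin; apply: limn_average_le => [n|e e0]; first exact: join_entropy_ge0 measurable_shift pA.
exact: join_entropy_upper.
Qed.

End pressure_upper.

(** * Measures with prescribed values on cylinders *)

Section word_measure.
Context {R : realType} (m : seq symbol -> R).
Hypotheses (m_ge0 : forall u, 0 <= m u) (m_nil : m [::] = 1)
  (m_rcons : forall u, m u = m (rcons u sym1) + m (rcons u sym2) + m (rcons u sym3)).

(* The intervals of the words [rcons v b] subdivide the interval
   [l, l + m v) of [v] from left to right. *)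
Definition offset v (b : symbol) : R :=
  if b == sym1 then 0 else if b == sym2 then m (rcons v sym1)
  else m (rcons v sym1) + m (rcons v sym2).

Definition next_symbol (x : R) (s : seq symbol * R) : symbol :=
  if x < s.2 + m (rcons s.1 sym1) then sym1
  else if x < s.2 + (m (rcons s.1 sym1) + m (rcons s.1 sym2)) then sym2 else sym3.

Definition next_state x (s : seq symbol * R) :=
  (rcons s.1 (next_symbol x s), s.2 + offset s.1 (next_symbol x s)).

(** A digit expansion of [x]: the state records the word read so far and the left end of its
    interval, and the next symbol names the subinterval containing [x]. *)
Definition coding x s : Sigma3 := fun n => next_symbol x (iter n (next_state x) s).

(** The distance from the left end of the interval of [v] to that of [v ++ u]. *)
Fixpoint endpoint v u : R :=
  if u is b :: u' then offset v b + endpoint (rcons v b) u' else 0.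

Lemma symbolP (b : symbol) : [\/ b = sym1, b = sym2 | b = sym3].
Proof.
have [|/symbol_neq2] := eqVneq b sym2; first by move->; constructor 2.
by case=> ->; [constructor 1|constructor 3].
Qed.

Lemma offset_le v b : 0 <= offset v b /\ offset v b + m (rcons v b) <= m v.
Proof.
have h1 := m_ge0 (rcons v sym1); have h2 := m_ge0 (rcons v sym2).
have h3 := m_ge0 (rcons v sym3); rewrite (m_rcons v).
by case: (symbolP b) => ->; rewrite /offset /=; split; lra.
Qed.

Lemma endpoint_le v u : 0 <= endpoint v u /\ endpoint v u + m (v ++ u) <= m v.
Proof.
elim: u v => [|b u IH] v /=; first by rewrite cats0 add0r.
have := IH (rcons v b); rewrite cat_rcons => -[h1 h2].
by have [h3 h4] := offset_le v b; split; lra.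
Qed.

Lemma next_symbolP (x : R) v (l : R) b : l <= x < l + m v ->
  next_symbol x (v, l) = b <->
  l + offset v b <= x < l + offset v b + m (rcons v b).
Proof.
have h1 := m_ge0 (rcons v sym1); have h2 := m_ge0 (rcons v sym2).
have h3 := m_ge0 (rcons v sym3); rewrite (m_rcons v) => /andP[lx xl].
rewrite /next_symbol /=; case: ltP => hx1; [|case: ltP => hx2].
all: by case: (symbolP b) => ->; rewrite /offset /=; split=> //;
  try (by move=> _; apply/andP; split; lra);
  try (by move=> /(congr1 (@nat_of_ord 3)));
  by move=> /andP[k1 k2]; exfalso; lra.
Qed.

Lemma codingP (x : R) u v (l : R) : l <= x < l + m v ->
  prefix (size u) (coding x (v, l)) = u <->
  l + endpoint v u <= x < l + endpoint v u + m (v ++ u).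
Proof.
elim: u v l => [|b u IH] v l lx; first by rewrite /= cats0 addr0; split.
have cS : shift (coding x (v, l)) = coding x (next_state x (v, l)).
  by apply/funext => n; rewrite /shift /coding iterSr.
rewrite [size _]/= prefixS cS [endpoint _ _]/= addrA.
have c0 : coding x (v, l) 0%N = next_symbol x (v, l) by [].
have nP := next_symbolP b lx.
have [E|N] := eqVneq (next_symbol x (v, l)) b.
  have := IH (rcons v b) (l + offset v b) (nP.1 E).
  rewrite c0 /next_state /= E cat_rcons => <-; split=> [[]//|->//].
split=> [[E]|]; first by rewrite c0 in E; rewrite E eqxx in N.
have [h1 h2] := endpoint_le (rcons v b) u; rewrite cat_rcons in h2.
move=> /andP[k1 k2]; suff /eqP : next_symbol x (v, l) = b by rewrite (negbTE N).
by apply/nP; apply/andP; split; lra.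
Qed.

(** Points outside [0, 1) are sent to 0, so that the coding is meaningful everywhere; this enlarges
    some preimages by the null set [out]. *)
Let unit_point (x : R) : R := if 0 <= x < 1 then x else 0.
Let X (x : R) : borel_Sigma3 := coding (unit_point x) ([::], 0).
Let I u : set R := `[endpoint [::] u, endpoint [::] u + m u[%classic.
Let out : set R := ~` `[0, 1[%classic.

Let XE u : X @^-1` (cyl u) = I u `|` (if 0 \in I u then out else set0).
Proof.
have upP x : 0 <= unit_point x < 0 + m [::].
  by rewrite m_nil add0r /unit_point; case: ifP => // _; rewrite lexx ltr01.
have [h1 h2] := endpoint_le [::] u; rewrite cat0s m_nil in h2.
have E x : X x \in cyl u = (unit_point x \in I u).
  apply/idP/idP; rewrite !inE /I /= in_itv /=.
    by move/(codingP u (upP x)).1; rewrite add0r cat0s.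
  by move=> h; apply/(codingP u (upP x)); rewrite add0r cat0s.
apply/seteqP; split=> x /=; rewrite -[cyl u _]in_setE E in_setE.
  rewrite /unit_point; case: ifPn => x01 Ix; first by left.
  by right; rewrite mem_set // /out /= in_itv /=; apply/negP.
rewrite /unit_point; case=> [Ix|].
  have := Ix; rewrite /I /= in_itv /= => /andP[k1 k2].
  by rewrite (_ : 0 <= x < 1) //; apply/andP; split; lra.
case: ifPn => // /set_mem I0; rewrite /out /= in_itv /= => /negP /negbTE -> //.
Qed.

Let mX : measurable_fun setT (X : measurableTypeR R -> borel_Sigma3).
Proof.
apply: (measurability [set A : set borel_Sigma3 | A = set0 \/ exists u, A = cyl u]).
  by rewrite measurable_Sigma3E.
move=> _ [_ [->|[u ->]] <-]; rewrite setTI ?preimage_set0 // XE.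
apply: measurableU; first exact: measurable_itv.
by case: (0 \in I u); [apply: measurableC; exact: measurable_itv|exact: measurable0].
Qed.

Let P := uniform_prob (@ltr01 R).

Let PI (l h : R) : 0 <= l -> l <= h -> h <= 1 -> P `[l, h[%classic = (h - l)%:E.
Proof.
move=> l0 lh h1; rewrite /P /uniform_prob.
rewrite (eq_integral (fun=> 1%:E)) ?integral_cst ?mul1e //=.
  rewrite lebesgue_measure_itv /= lte_fin.
  by move: lh; rewrite le_eqVlt => /predU1P[->|->]; rewrite ?ltxx ?subrr // EFinB.
move=> x; rewrite inE /= in_itv /= => /andP[h2 h3].
rewrite /uniform_pdf (_ : 0 <= x <= 1) ?subr0 ?invr1 //.
by apply/andP; split; lra.
Qed.

(** The law of the expansion of a uniform point of [0, 1): the points coded by words starting with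
    [u] form an interval of length [m u], up to a null set. *)
Lemma word_measure : exists mu : probability borel_Sigma3 R,
  forall u, mu (cyl u) = (m u)%:E.
Proof.
pose mXm := isMeasurableFun.Build _ _ (measurableTypeR R) borel_Sigma3 X mX.
pose Xf : {RV P >-> borel_Sigma3} := MeasurableFun.Pack (MeasurableFun.Class mXm).
exists (distribution P Xf) => u.
rewrite /distribution /pushforward /= XE.
have [h1 h2] := endpoint_le [::] u; rewrite cat0s m_nil in h2.
have h3 := m_ge0 u.
have PIu : P (I u) = (m u)%:E by rewrite PI; [congr EFin; lra|lra|lra|lra].
case: ifP => _; last by rewrite setU0.
rewrite measureU0; [exact: PIu|exact: measurable_itv|apply: measurableC; exact: measurable_itv|].
have PC : P out = (1 - P `[0%R, 1%R[%classic)%E.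
  exact: (@probability_setC _ _ _ P _ (measurable_itv `[0, 1[)).
by rewrite [LHS]PC PI // subr0 -EFinB subrr.
Qed.

End word_measure.

(** * The renewal measure *)

(** The preimage of [cyl u] under the shift is the disjoint union of three cylinders, so the
    hypothesis is invariance on cylinders, and these determine the measure. *)
Lemma invariant_measure_cyl (R : realType) (mu : probability borel_Sigma3 R) :
  (forall u, mu (cyl u) = mu (cyl (sym1 :: u)) + mu (cyl (sym2 :: u)) + mu (cyl (sym3 :: u)))%E ->
  invariant_measure bshift mu.
Proof.
move=> h.
pose fm := isMeasurableFun.Build _ _ borel_Sigma3 borel_Sigma3 bshift measurable_shift.
pose f : {mfun borel_Sigma3 >-> borel_Sigma3} := MeasurableFun.Pack (MeasurableFun.Class fm).
move=> A mA; rewrite -[LHS]/(pushforward mu f A); apply: cyl_unique => // [|u].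
  by rewrite /= /pushforward preimage_setT probability_setT ltry.
rewrite [RHS](h u) [LHS]/(mu (f @^-1` cyl u)).
have -> : f @^-1` cyl u = cyl (sym1 :: u) `|` cyl (sym2 :: u) `|` cyl (sym3 :: u).
  apply/seteqP; split=> x; rewrite /cyl /= !prefixS.
    by move=> ->; case: (symbolP (x 0%N)) => ->; [left; left|left; right|right].
  by move=> [[[_ ->]|[_ ->]]|[_ ->]].
have dis b b' : b != b' -> cyl (b :: u) `&` cyl (b' :: u) = set0.
  move=> /eqP bb'; apply/seteqP; split=> x //; rewrite /cyl /= !prefixS.
  by move=> [[-> _] [E _]]; exact: bb'.
transitivity (mu (cyl (sym1 :: u) `|` cyl (sym2 :: u)) + mu (cyl (sym3 :: u)))%E.
  apply: (measureU mu); [by apply: measurableU; exact: measurable_cyl|exact: measurable_cyl|].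
  by rewrite setIUl !dis ?setU0.
by congr (_ + _)%E; apply: (measureU mu); [exact: measurable_cyl|exact: measurable_cyl|exact: dis].
Qed.

Section renewal_weights.
Context {R : realType} (S : nat -> R) (q : R) (N : nat).
Let F := \sum_(n < N.+1) expR (S n - n.+1%:R * q).
Hypothesis F2 : 2 <= F.
Let p := ln 2 + q.
Let c := 2 / F.
Let F0 : 0 < F. Proof. by apply: lt_le_trans F2. Qed.
Let c0 : 0 < c. Proof. by rewrite divr_gt0. Qed.

(** The probability of one given excursion of [n] letters followed by 2. Since [p] contains [ln 2],
    the factor [c] normalises the sum of [2 ^+ n * g n] to 1. *)
Definition renewal_weight (n : nat) : R :=
  if (n <= N)%N then c * expR (S n - n.+1%:R * p) else 0.
Local Notation g := renewal_weight.

(** The probability that an excursion starts with a given word of [j] letters: it extends to [n]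
    letters in [2 ^+ (n - j)] ways. *)
Definition renewal_tail (j : nat) : R :=
  (2 ^+ j)^-1 * \sum_(j <= n < N.+1) 2 ^+ n * g n.
Local Notation theta := renewal_tail.

(** The joint weight of [j] given letters different from 2, read just after a renewal, and then
    [u]. *)
Fixpoint tail_weight (j : nat) (u : seq symbol) : R :=
  if u is b :: u' then if b == sym2 then g j * tail_weight 0 u' else tail_weight j.+1 u'
  else theta j.

Lemma renewal_weight_gt0 n : (n <= N)%N -> 0 < g n.
Proof. by rewrite /g => ->; rewrite mulr_gt0 ?expR_gt0. Qed.

Lemma renewal_weight_ge0 n : 0 <= g n.
Proof. by rewrite /g; case: ifP => // _; rewrite mulr_ge0 ?expR_ge0 // ltW. Qed.

Lemma renewal_tail0 : theta 0 = 1.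
Proof.
rewrite /theta expr0 invr1 mul1r big_mkord.
rewrite (eq_bigr (fun n : 'I_N.+1 => F^-1 * expR (S n - n.+1%:R * q))).
  by rewrite -big_distrr /= mulVf ?gt_eqF.
move=> n _; rewrite /g -ltnS ltn_ord /c /p.
have -> : S n - n.+1%:R * (ln 2 + q) = (S n - n.+1%:R * q) - n.+1%:R * ln 2 by ring.
have t0 : (2 : R) ^+ n != 0 by rewrite gt_eqF // exprn_gt0.
rewrite [expR (_ - _ * ln 2)]expRB expRM_natl lnK ?posrE // exprS.
by field; rewrite t0 gt_eqF.
Qed.

Lemma renewal_tail_ge0 j : 0 <= theta j.
Proof.
rewrite mulr_ge0 ?invr_ge0 ?exprn_ge0 // sumr_ge0 // => n _.
by rewrite mulr_ge0 ?exprn_ge0 ?renewal_weight_ge0.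
Qed.

Lemma renewal_tail_far j : (N < j)%N -> theta j = 0.
Proof. by move=> Nj; rewrite /theta big_geq // mulr0. Qed.

Lemma renewal_weight_far j : (N < j)%N -> g j = 0.
Proof. by move=> Nj; rewrite /g leqNgt Nj. Qed.

Lemma renewal_tailS j : theta j = g j + 2 * theta j.+1.
Proof.
have t0 : (2 : R) ^+ j != 0 by rewrite gt_eqF // exprn_gt0.
have [Nj|jN] := ltnP N j.
  by rewrite (renewal_tail_far Nj) (renewal_weight_far Nj) (renewal_tail_far (leqW Nj)) mulr0 addr0.
rewrite /theta big_ltn // exprS; field; exact: t0.
Qed.

Lemma renewal_tail_gt0 j : (j <= N)%N -> 0 < theta j.
Proof.
move=> jN; rewrite renewal_tailS ltr_pwDl ?renewal_weight_gt0 //.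
by rewrite mulr_ge0 ?renewal_tail_ge0.
Qed.

Lemma tail_weight_ge0 j u : 0 <= tail_weight j u.
Proof.
elim: u j => [|b u IH] j /=; first exact: renewal_tail_ge0.
by case: ifP => _ //; rewrite mulr_ge0 ?renewal_weight_ge0.
Qed.

Lemma tail_weight_far j u : (N < j)%N -> tail_weight j u = 0.
Proof.
elim: u j => [|b u IH] j Nj /=; first exact: renewal_tail_far.
by case: ifP => _; [rewrite renewal_weight_far // mul0r|rewrite IH // ltnW].
Qed.

Lemma tail_weight_rcons j u : tail_weight j u =
  tail_weight j (rcons u sym1) + tail_weight j (rcons u sym2) + tail_weight j (rcons u sym3).
Proof.
elim: u j => [|b u IH] j /=; first by rewrite renewal_tail0 renewal_tailS; ring.
by case: ifP => _; rewrite IH ?mulrDr.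
Qed.

(** Here [2 ^+ j * theta j] is the probability that an excursion has at least [j] letters, so the
    sum is the mean of its duration n+1. *)
Definition mean_return : R := \sum_(j < N.+1) 2 ^+ j * theta j.

Lemma mean_return_gt0 : 0 < mean_return.
Proof.
rewrite /mean_return big_ord_recl /= expr0 mul1r renewal_tail0 ltr_pwDl // sumr_ge0 // => j _.
by rewrite mulr_ge0 ?exprn_ge0 ?renewal_tail_ge0.
Qed.

(** The stationary version of the renewal process: the age at time 0 is averaged, with [2 ^+ j]
    possible pasts of age [j]. *)
Definition stationary_weight u := mean_return^-1 * \sum_(j < N.+1) 2 ^+ j * tail_weight j u.

Lemma stationary_weight_ge0 u : 0 <= stationary_weight u.
Proof.
rewrite mulr_ge0 ?invr_ge0 ?(ltW mean_return_gt0) // sumr_ge0 // => j _.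
by rewrite mulr_ge0 ?exprn_ge0 ?tail_weight_ge0.
Qed.

Lemma stationary_weight_nil : stationary_weight [::] = 1.
Proof. by rewrite /stationary_weight mulVf // gt_eqF // mean_return_gt0. Qed.

Lemma stationary_weight_rcons u : stationary_weight u =
  stationary_weight (rcons u sym1) + stationary_weight (rcons u sym2) + stationary_weight (rcons u sym3).
Proof.
rewrite /stationary_weight -!mulrDr -!big_split /=; congr (_ * _).
by apply: eq_bigr => j _; rewrite tail_weight_rcons !mulrDr.
Qed.

(** This gives invariance under the shift. Prepending 1 or 3 passes from age [j] to [j.+1];
    prepending 2 resets the age to 0 with total mass [theta 0 = 1]. Age [N.+1] has weight 0, so
    reindexing loses nothing. *)
Lemma stationary_weight_cons u : stationary_weight u =
  stationary_weight (sym1 :: u) + stationary_weight (sym2 :: u) + stationary_weight (sym3 :: u).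
Proof.
rewrite /stationary_weight -!mulrDr -!big_split /=; congr (_ * _).
have := renewal_tail0; rewrite /theta expr0 invr1 mul1r big_mkord => h1.
have -> : \sum_(j < N.+1) (2 ^+ j * tail_weight j.+1 u + 2 ^+ j * (g j * tail_weight 0 u) +
    2 ^+ j * tail_weight j.+1 u) =
    tail_weight 0 u + \sum_(j < N.+1) 2 ^+ j.+1 * tail_weight j.+1 u.
  transitivity ((\sum_(j < N.+1) 2 ^+ j * g j) * tail_weight 0 u +
      \sum_(j < N.+1) 2 ^+ j.+1 * tail_weight j.+1 u); last by rewrite h1 mul1r.
  rewrite big_distrl /= -big_split /=.
  by apply: eq_bigr => j _; rewrite exprS; ring.
rewrite [in RHS]big_ord_recr /= (@tail_weight_far N.+1) // mulr0 addr0.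
by rewrite [in LHS]big_ord_recl /= expr0 mul1r.
Qed.

Definition word_log (u : seq symbol) : R :=
  (count_mem sym2 u)%:R * ln c + excursion_sum S 0 u - (size u)%:R * p.

(** The index [i] is the age reached after the last letter of [u]. Its tail is the only factor that
    is not a product over completed excursions, and it takes finitely many values. *)
Lemma tail_weight_log j u : tail_weight j u = 0 \/ exists2 i, (i <= N)%N &
  tail_weight j u = expR (ln (theta i) + i%:R * p +
    ((count_mem sym2 u)%:R * ln c + excursion_sum S j u - (j + size u)%:R * p)).
Proof.
elim: u j => [|b u IH] j /=.
  have [Nj|jN] := ltnP N j; first by left; exact: renewal_tail_far.
  right; exists j => //.
  by rewrite mul0r addr0 add0r addn0 addrK lnK // posrE renewal_tail_gt0.
case: ifPn => bE; last first.
  case: (IH j.+1) => [->|[i iN ->]]; [by left|right; exists i => //].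
  by rewrite add0n addSnnS.
have [Nj|jN] := ltnP N j; first by left; rewrite renewal_weight_far // mul0r.
case: (IH 0%N) => [->|[i iN ->]]; first by left; rewrite mulr0.
right; exists i => //; rewrite /g jN -[X in X * _ * _](lnK c0) -!expRD; congr expR.
by rewrite add1n -[(count_mem _ _).+1%:R]natr1 add0n addnS -addSn natrD; ring.
Qed.

Lemma excursion_sum_age (M : R) j u : (forall n, `|S n.+1 - S n| <= M) ->
  `|excursion_sum S j u - excursion_sum S 0 u| <= j%:R * M.
Proof.
move=> SM; have M0 : 0 <= M by exact: le_trans (SM 0%N).
have step i : `|excursion_sum S i.+1 u - excursion_sum S i u| <= M.
  elim: u i => [|b u IH] i /=; first by rewrite subrr normr0.
  by case: ifP => _ //; rewrite opprD addrACA subrr addr0.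
elim: j => [|j IH]; first by rewrite subrr normr0 mul0r.
rewrite -[X in `|X|](subrKA (excursion_sum S j u)) (le_trans (ler_normD _ _)) //.
by rewrite -natr1 mulrDl mul1r addrC lerD.
Qed.

(** Truncation bounds all ages by [N], so the initial age and the final tail change the logarithm by
    a bounded amount. The average over ages lies between one nonzero term and finitely many such
    bounds. *)
Lemma stationary_weight_log (M : R) : (forall n, `|S n.+1 - S n| <= M) ->
  exists C, forall u, 0 < stationary_weight u ->
    `|ln (stationary_weight u) - word_log u| <= C.
Proof.
move=> SM; have M0 : 0 <= M by exact: le_trans (SM 0%N).
pose K : R := \sum_(i < N.+1) `|ln (theta i) + i%:R * p|.
have KP i : (i <= N)%N -> `|ln (theta i) + i%:R * p| <= K.
  move=> iN; rewrite /K (bigD1 (Ordinal (iN : (i < N.+1)%N))) //= lerDl sumr_ge0 //.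
pose D : R := K + N%:R * M + N%:R * `|p|.
have twP j u : (j <= N)%N -> tail_weight j u = 0 \/
    expR (word_log u - D) <= tail_weight j u <= expR (word_log u + D).
  move=> jN; case: (tail_weight_log j u) => [|[i iN ->]]; [by left|right].
  rewrite !ler_expR /word_log /D.
  have := KP i iN; have := excursion_sum_age j u SM.
  have h1 : j%:R * M <= N%:R * M by rewrite ler_wpM2r // ler_nat.
  have h2 : `|j%:R * p| <= N%:R * `|p|.
    by rewrite normrM normr_nat ler_wpM2r // ler_nat.
  move: h2; rewrite !ler_norml natrD !mulrDl => /andP[a1 a2] /andP[a3 a4] /andP[a5 a6].
  by apply/andP; split; lra.
pose T : R := \sum_(j < N.+1) 2 ^+ j.
have T0 : 0 < T.
  by rewrite /T big_ord_recl /= expr0 ltr_pwDl // sumr_ge0 // => j _; rewrite exprn_ge0.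
have tau0 := mean_return_gt0.
exists (D + `|ln (mean_return^-1 * T)| + `|ln mean_return^-1|) => u u0.
have D0 : 0 <= D.
  by rewrite /D !addr_ge0 ?mulr_ge0 // sumr_ge0.
have up : ln (stationary_weight u) <= ln (mean_return^-1 * T) + (word_log u + D).
  rewrite -[X in _ + X]expRK -lnM ?posrE ?mulr_gt0 ?invr_gt0 ?expR_gt0 //.
  rewrite ler_ln; [|by rewrite posrE|by rewrite posrE !mulr_gt0 ?invr_gt0 ?expR_gt0].
  rewrite -mulrA.
  apply: ler_wpM2l; first by rewrite invr_ge0 ltW.
  rewrite big_distrl /=; apply: ler_sum => j _; apply: ler_wpM2l; first exact: exprn_ge0.
  by case: (twP j u (ltn_ord j)) => [->|/andP[]//]; exact: expR_ge0.
have lo : ln mean_return^-1 + (word_log u - D) <= ln (stationary_weight u).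
  have [j tj] : exists j : 'I_N.+1, tail_weight j u != 0.
    apply/existsP; apply: contraPT u0 => /existsPn h.
    rewrite /stationary_weight big1 ?mulr0 ?ltxx // => j _.
    by have := h j; rewrite negbK => /eqP ->; rewrite mulr0.
  rewrite -[X in _ + X]expRK -lnM ?posrE ?mulr_gt0 ?invr_gt0 ?expR_gt0 //.
  rewrite ler_ln; [|by rewrite posrE !mulr_gt0 ?invr_gt0 ?expR_gt0|by rewrite posrE].
  apply: ler_wpM2l; first by rewrite invr_ge0 ltW.
  rewrite (bigD1 j) //= -[X in X <= _]addr0; apply: lerD; last first.
    by apply: sumr_ge0 => i _; rewrite mulr_ge0 ?exprn_ge0 ?tail_weight_ge0.
  case: (twP j u (ltn_ord j)) tj => [->|/andP[h _] _]; first by rewrite eqxx.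
  apply: le_trans h _; by rewrite ler_peMl ?tail_weight_ge0 // exprn_ege1 // ler1n.
have n1 := ler_norm (ln (mean_return^-1 * T)).
have n3 := normr_ge0 (ln (mean_return^-1 * T)); have n4 := normr_ge0 (ln mean_return^-1).
have n5 := ler_norm (- ln mean_return^-1); rewrite normrN in n5.
by rewrite ler_norml; apply/andP; split; lra.
Qed.

End renewal_weights.

(** * Lower bound for the pressure *)

Section pressure_lower.
Context {R : realType}.

Definition first_symbol (x : borel_Sigma3) : 'I_3 := x 0%N.

Lemma measurable_partition_first_symbol :
  measurable_partition (fun j : 'I_3 => [set x | first_symbol x = j]).
Proof.
split=> [j||]; first exact: measurable_coord.
- by move=> i j _ _ [x [/= <- <-]].
- by apply/seteqP; split=> // x _; exists (first_symbol x).
Qed.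

Lemma itinerary_prefix n (x : borel_Sigma3) :
  [seq itinerary bshift first_symbol n x i | i <- enum 'I_n] = prefix n x.
Proof.
rewrite /prefix /mkseq -val_enum_ord -map_comp; apply: eq_map => i /=.
by rewrite ffunE /first_symbol iter_shift addn0.
Qed.

Lemma join_atom_cyl n (w : {ffun 'I_n -> 'I_3}) :
  join_atom bshift (fun j : 'I_3 => [set x | first_symbol x = j]) w =
  cyl [seq w i | i <- enum 'I_n].
Proof.
rewrite (join_atomE bshift (al := first_symbol)) //.
apply/seteqP; split=> x; rewrite /cyl /= size_map size_enum_ord.
  by move=> <-; rewrite itinerary_prefix.
rewrite -itinerary_prefix => /eq_in_map h; apply/ffunP => i.
by apply: h; rewrite mem_enum.
Qed.

Lemma count_sym2_prefix n (x : borel_Sigma3) :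
  (count_mem sym2 (prefix n x))%:R =
  \sum_(i < n) (\1_[set x | x 0%N = sym2] \o iter i bshift) x :> R.
Proof.
elim: n x => [|n IH] x; first by rewrite big_ord0.
rewrite prefixS big_ord_recl /= natrD IH; congr (_ + _).
  by rewrite indicE; case: eqVneq => [E|/eqP E]; [rewrite mem_set|rewrite memNset].
by apply: eq_bigr => i _; rewrite -[shift (iter _ _ x)]/(iter i.+1 shift x) iterSr.
Qed.

Lemma expect_close d (X : measurableType d) (mu : probability X R) (f h : X -> R) (D : R) :
  bounded_measurable f -> bounded_measurable h -> (forall x, `|f x - h x| <= D) ->
  `|expect mu f - expect mu h| <= D.
Proof.
move=> bf bh fh; have bD := bounded_measurable_cst X D.
have h1 : expect mu f <= expect mu (fun x => h x + cst D x).
  apply: expect_le => //; first exact: bounded_measurableD.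
  by move=> x /=; have := fh x; rewrite ler_norml => /andP[_]; rewrite lerBlDl.
have h2 : expect mu h <= expect mu (fun x => f x + cst D x).
  apply: expect_le => //; first exact: bounded_measurableD.
  by move=> x /=; have := fh x; rewrite ler_norml => /andP[+ _]; lra.
rewrite expectD // expect_cst in h1; rewrite expectD // expect_cst in h2.
by rewrite ler_norml; apply/andP; split; lra.
Qed.

Lemma pressure_ge (a : nat -> R) (q : R) (N : nat) : a n @[n --> \oo] --> (0 : R) ->
  2 <= \sum_(n < N.+1) expR (\sum_(k < n.+1) a k - n.+1%:R * q) ->
  ((ln 2 + q)%:E <= pressure bshift (grid_function a))%E.
Proof.
move=> a0; pose S n := \sum_(k < n.+1) a k.
move=> F2'; have F2 : 2 <= \sum_(n < N.+1) expR (S n - n.+1%:R * q) by [].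
have [mu muE] := word_measure (stationary_weight_ge0 F2) (stationary_weight_nil F2)
  (stationary_weight_rcons F2).
have inv : invariant_measure bshift mu.
  apply: invariant_measure_cyl => u.
  by rewrite !muE -!EFinD -stationary_weight_cons.
pose c : R := 2 / \sum_(n < N.+1) expR (S n - n.+1%:R * q).
pose M0 : set borel_Sigma3 := [set x | x 0%N = sym2].
have mM0 : measurable M0 by exact: measurable_coord.
have lnc : ln c <= 0.
  by apply: ln_le0; rewrite /c ler_pdivrMr ?mul1r // (lt_le_trans _ F2).
pose Ephi := expect mu (grid_function a).
(* The entropy of the first-symbol partition, as shown by [cvH]. The term with [ln c] is the surplus
   of the truncated sum over 2, and it is nonnegative after the sign. *)
pose v := ln 2 + q - Ephi - ln c * fine (mu M0).
have [K K0 aK] := grid_bounded a0.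
have SK n : `|S n.+1 - S n| <= K by rewrite /S big_ord_recr /= addrAC subrr add0r.
have [C0 HC0] := stationary_weight_log F2 SK.
have pP := measurable_partition_first_symbol; have [mP _ _] := pP.
pose wd n (w : {ffun 'I_n -> 'I_3}) := [seq w i | i <- enum 'I_n].
pose st := stationary_weight S q N; pose wl := word_log S q N.
(* Null atoms contribute nothing to the entropy, so any value is allowed there; [- wl] keeps [g]
   within [C0] of [- wl] on all words. *)
pose g n (w : {ffun 'I_n -> 'I_3}) := if st (wd n w) == 0 then - wl (wd n w) else - ln (st (wd n w)).
have HE n : join_entropy bshift mu (fun j : 'I_3 => [set x | first_symbol x = j]) n =
    expect mu (fun x => g n (itinerary bshift first_symbol n x)).
  rewrite (expect_itinerary mu measurable_shift mP (al := first_symbol)) //.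
  rewrite /join_entropy -sumrN; apply: eq_bigr => w _.
  rewrite join_atom_cyl muE /= /g -/(wd n w) -/(st _).
  by case: eqP => [->|_]; rewrite ?mulr0 ?mul0r ?oppr0 // mulNr mulrC.
have C00 : 0 <= C0.
  by apply: le_trans (HC0 [::] _); rewrite ?stationary_weight_nil.
have gwl n x : `|g n (itinerary bshift first_symbol n x) + wl (prefix n x)| <= C0.
  rewrite /g /wd itinerary_prefix; case: eqP => [_|/eqP h]; first by rewrite addNr normr0.
  rewrite -normrN opprD opprK; apply: HC0.
  by rewrite lt_neqAle eq_sym h stationary_weight_ge0.
have bM : bounded_measurable (\1_M0 : borel_Sigma3 -> R) by exact: bounded_measurable_indic.
have mit i : measurable_fun setT (iter i bshift).
  elim: i => [|i IH]; first exact: measurable_id.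
  by rewrite (_ : iter _ _ = shift \o iter i shift) //; exact: measurableT_comp measurable_shift IH.
have EM i : expect mu (\1_M0 \o iter i bshift) = fine (mu M0).
  elim: i => [|i IH]; first by rewrite -expect_indic.
  rewrite -IH -[RHS](expect_invariant measurable_shift inv (bounded_measurable_comp (mit i) bM)).
  by congr expect; apply/funext => x; rewrite /= -iterSr.
(* The logarithm of the weight of a cylinder is, up to a sublinear error, a
   Birkhoff sum of [phi - p + ln c * 1_[2]]. *)
pose psi n (x : borel_Sigma3) : R := ln c * \sum_(i < n) (\1_M0 \o iter i bshift) x + birkhoff a n x - n%:R * (ln 2 + q).
have bpsi n : bounded_measurable (fun x => - psi n x).
  rewrite (_ : (fun x => _) = fun x => (- ln c * \sum_(i < n) (\1_M0 \o iter i bshift) x + -1 * birkhoff a n x) + n%:R * (ln 2 + q)).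
    apply: bounded_measurableD; last exact: bounded_measurable_cst.
    apply: bounded_measurableD; apply: bounded_measurableZ.
      by apply: bounded_measurable_sum => i; exact: (bounded_measurable_comp (mit i) bM).
    exact: bounded_measurable_birkhoff.
  by apply/funext => x; rewrite /psi; ring.
have Epsi n : expect mu (fun x => - psi n x) = n%:R * v.
  rewrite (_ : (fun x => _) = fun x => (- ln c * \sum_(i < n) (\1_M0 \o iter i bshift) x + -1 * birkhoff a n x) + n%:R * (ln 2 + q)); last first.
    by apply/funext => x; rewrite /psi; ring.
  have bS : bounded_measurable (fun x : borel_Sigma3 => \sum_(i < n) (\1_M0 \o iter i bshift) x : R).
    by apply: bounded_measurable_sum => i; exact: (bounded_measurable_comp (mit i) bM).
  have bB := bounded_measurable_birkhoff a0 n.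
  rewrite (expectD mu (g := cst _)); [|by apply: bounded_measurableD; exact: bounded_measurableZ|exact: bounded_measurable_cst].
  rewrite expect_cst expectD; [|exact: bounded_measurableZ|exact: bounded_measurableZ].
  rewrite expectZ // expectZ // expect_birkhoff // expect_sum; last first.
    by move=> i; exact: (bounded_measurable_comp (mit i) bM).
  rewrite (eq_bigr (fun=> fine (mu M0))) => [|i _]; last exact: EM.
  rewrite sumr_const card_ord -[_ *+ n]mulr_natl /v.
  by rewrite -[X in _ + X = _]/(n%:R * (ln 2 + q)) -/Ephi; ring.
have cvH : join_entropy bshift mu (fun j : 'I_3 => [set x | first_symbol x = j]) n / n%:R @[n --> \oo] --> v.
  apply: cvg_average => e e0; have [C1 C10 HC1] := birkhoff_excursion_sum a0 e0.
  exists (C0 + C1) => n.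
  have h x : `|g n (itinerary bshift first_symbol n x) + psi n x| <= n%:R * e + (C0 + C1).
    have -> : psi n x = wl (prefix n x) + (birkhoff a n x - excursion_sum S 0 (prefix n x)).
      rewrite /psi /wl /word_log size_mkseq count_sym2_prefix -/M0 -/c; ring.
    rewrite addrA (le_trans (ler_normD _ _)) //.
    by have := gwl n x; have := HC1 n x; rewrite -/(S _) => h1 h2; lra.
  have bg : bounded_measurable (fun x => g n (itinerary bshift first_symbol n x)).
    exact: (bounded_measurable_itinerary measurable_shift mP).
  rewrite HE -Epsi; apply: expect_close => // x.
  by rewrite opprK.
have ent : (v%:E <= entropy bshift mu)%E.
  apply: ereal_sup_ubound; exists 3%N, (fun j : 'I_3 => [set x | first_symbol x = j]).
  by split => //; congr EFin; apply/esym/cvg_lim.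
have bphi := bounded_measurable_grid a0.
apply: (@le_trans _ _ (entropy bshift mu + (Ephi)%:E)%E).
  apply: (@le_trans _ _ (v%:E + Ephi%:E)%E); last by rewrite leeD2r.
  rewrite -EFinD lee_fin /v addrAC subrK lerDl oppr_ge0.
  by rewrite mulr_le0_ge0 // fine_ge0.
apply: ereal_sup_ubound; exists mu; split => //.
  by rewrite integral_expect // -EFinN ltry.
by rewrite integral_expect.
Qed.

End pressure_lower.

(** * The implicit equation of the pressure *)

Section exp_inequalities.
Context {R : realType}.
Implicit Types x y q : R.

Lemma expR_le1Mx x : expR x <= 1 + x * expR x.
Proof.
have := expR_ge1Dx (- x); rewrite expRN => h.
have e0 := expR_gt0 x; have := ler_wpM2r (ltW e0) h.
by rewrite mulVf ?gt_eqF // mulrDl mul1r; lra.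
Qed.

Lemma expR_taylor2_le x : expR x <= 1 + x + x ^+ 2 * expR `|x|.
Proof.
have h1 := expR_le1Mx x; have h2 := expR_ge1Dx x.
have [x0|x0] := leP 0 x.
  by rewrite ger0_norm //; have := ler_wpM2l x0 h1; rewrite expr2; lra.
have h3 : 1 <= expR `|x| by rewrite -expR0 ler_expR.
have := ler_wpM2l (sqr_ge0 x) h3; have := ler_wnM2l (ltW x0) h2; lra.
Qed.

Lemma geometric_expR_le q N : 0 < q -> \sum_(n < N) expR (- (n.+1%:R * q)) <= q^-1.
Proof.
move=> q0; apply: (@le_trans _ _ ((1 - expR (- (N%:R * q))) / q)); last first.
  by rewrite -[leRHS]mul1r ler_wpM2r ?invr_ge0 ?(ltW q0) // gerBl expR_ge0.
elim: N => [|N IH]; first by rewrite big_ord0 mul0r oppr0 expR0 subrr mul0r.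
rewrite big_ord_recr /=; apply: (le_trans (lerD IH (lexx _))).
rewrite ler_pdivlMr // mulrDl divfK ?gt_eqF //.
have -> : expR (- (N%:R * q)) = expR (- (N.+1%:R * q)) * expR q.
  by rewrite -expRD -natr1 mulrDl mul1r; congr expR; ring.
have := expR_ge1Dx q; have := expR_ge0 (- (N.+1%:R * q)); nra.
Qed.

Lemma sqr_le_expR x : 0 <= x -> x ^+ 2 <= 4 * expR x.
Proof.
move=> x0; have -> : expR x = expR (x / 2) ^+ 2 by rewrite -expRM_natl; congr expR; field.
have h := expR_ge1Dx (x / 2).
have h2 : 0 <= x / 2 by rewrite divr_ge0.
nra.
Qed.

End exp_inequalities.

Section limits_and_derivatives.
Context {R : realType}.

Lemma bounded_sum_cvg (u : nat -> R) (M : R) : (forall N, \sum_(n < N) `|u n| <= M) ->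
  exists l : R, (\sum_(n < N) u n) @[N --> \oo] --> l.
Proof.
move=> uM; suff : cvgn (series u).
  move/cvg_ex => [l ul]; exists l.
  by rewrite (_ : (fun N => _) = series u) //; apply/funext => N; rewrite /series /= big_mkord.
apply: normed_cvg.
rewrite (_ : [normed series u] = fun N => \sum_(n < N) `|u n|); last first.
  by apply/funext => N; rewrite /normed_series_of /series /= big_mkord.
apply: nondecreasing_is_cvgn.
  by apply/nondecreasing_seqP => n; rewrite big_ord_recr /= lerDl.
by exists M => _ [N _ <-].
Qed.

Lemma derivable_squeeze (p : R -> R) (t r : R) :
  (forall e, 0 < e -> exists2 d, 0 < d &
    forall h, `|h| <= d -> `|p (t + h) - p t - r * h| <= e * `|h|) ->
  derivable p t 1 /\ derive1 p t = r.
Proof.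
move=> H; suff cv : h^-1 *: (p (h + t) - p t) @[h --> 0^'] --> r.
  split; last exact: cvg_lim.
  apply/cvg_ex; exists r.
  by rewrite (_ : (fun h => _) = (fun h => h^-1 *: (p (h + t) - p t))) //;
    apply/funext => h; rewrite /= [h *: 1]mulr1.
apply/cvgrPdist_le => e e0; have [d d0 Hd] := H _ e0; near=> h.
have h0 : h != 0 by near: h; exact: nbhs_dnbhs_neq.
have hd : `|h| <= d by near: h; apply: dnbhs0_le.
rewrite /= [_ *: _]mulrC -[r](mulfK h0) -mulrBl normrM normfV ler_pdivrMr ?normr_gt0 //.
by rewrite distrC [h + t]addrC; exact: Hd.
Unshelve. all: by end_near. Qed.

End limits_and_derivatives.

(** * Differentiability where the pressure exceeds log 2 *)

Section implicit_function.
Context {R : realType} (S : nat -> R) (Q : R -> R).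

Definition partial_gen N (t q : R) : R := \sum_(n < N) expR (t * S n - n.+1%:R * q).
Local Notation F := partial_gen.

Hypothesis S_sublinear : forall d, 0 < d -> exists2 C, 0 <= C & forall n, `|S n| <= d * n.+1%:R + C.
Hypothesis Q_ge0 : forall t, 0 <= Q t.
Hypothesis Q_le : forall t q, 0 <= q -> (forall N, F N t q <= 2) -> Q t <= q.
Hypothesis Q_ge : forall t q N, 2 <= F N t q -> q <= Q t.

Lemma partial_gen_mono M N t q : (M <= N)%N -> F M t q <= F N t q.
Proof.
move=> MN; rewrite /F -(subnKC MN) big_split_ord /= lerDl.
by apply: sumr_ge0 => n _; exact: expR_ge0.
Qed.

(** A finite sum above 2 leaves room to raise [q]: adding [eta] shrinks each of the first [N] terms
    by at most [expR (- (N%:R * eta))], and [eta] is chosen to bring the bound down to exactly 2. *)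
Lemma Q_gt N t q : 2 < F N t q -> q < Q t.
Proof.
move=> F2; have F0 : 0 < F N t q by exact: lt_trans F2.
case: N F2 F0 => [|N] F2 F0; first by rewrite /F big_ord0 ltxx in F0.
pose eta := ln (F N.+1 t q / 2) / N.+1%:R.
have eta0 : 0 < eta by rewrite divr_gt0 // ln_gt0 // ltr_pdivlMr // mul1r.
apply: (@lt_le_trans _ _ (q + eta)); first by rewrite ltrDl.
apply: (@Q_ge _ _ N.+1).
have -> : 2 = expR (- (N.+1%:R * eta)) * F N.+1 t q.
  rewrite /eta mulrCA mulfV ?gt_eqF // mulr1 expRN lnK ?posrE ?divr_gt0 //.
  by field; rewrite gt_eqF.
rewrite /F big_distrr /=; apply: ler_sum => n _.
rewrite -expRD ler_expR.
have : n.+1%:R * eta <= N.+1%:R * eta by rewrite ler_pM2r // ler_nat.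
lra.
Qed.

Lemma partial_gen_Q_le N t : F N t (Q t) <= 2.
Proof. by rewrite leNgt; apply/negP => /Q_gt; rewrite ltxx. Qed.

Section at_point.
Variables (t0 : R) (Qt0 : 0 < Q t0).
Let q0 := Q t0.
Let e n := expR (t0 * S n - n.+1%:R * q0).

(** Because [Q t0 > 0] and [S] is sublinear, the terms decay exponentially. The weight leaves room
    for a quadratic Taylor remainder whose exponent moves by up to [q0 / 4] per letter. *)
Lemma moment_bounded : exists2 M, 0 <= M & forall N,
  \sum_(n < N) e n * (n.+1%:R ^+ 2 * expR (n.+1%:R * (q0 / 4))) <= M.
Proof.
have d0 : 0 < q0 / 4 / (`|t0| + 1) by rewrite !divr_gt0 // ltr_wpDl.
have [C C0 SC] := S_sublinear d0.
have td : `|t0| * (q0 / 4 / (`|t0| + 1)) <= q0 / 4.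
  rewrite mulrA ler_pdivrMr ?ltr_wpDl // mulrC ler_wpM2l ?divr_ge0 ?(ltW Qt0) //.
  by rewrite lerDl.
(* The constant 256 is 4 * 8^2, from [sqr_le_expR] at [k * (q0 / 8)]. *)
pose B := 256 / q0 ^+ 2 * expR (`|t0| * C).
have B0 : 0 <= B by rewrite mulr_ge0 ?divr_ge0 ?sqr_ge0 ?expR_ge0.
exists (B * (q0 / 4)^-1).
  by rewrite mulr_ge0 // invr_ge0 divr_ge0 // ltW.
move=> N; apply: (@le_trans _ _ (B * \sum_(n < N) expR (- (n.+1%:R * (q0 / 4))))); last first.
  by rewrite ler_wpM2l // geometric_expR_le // divr_gt0.
rewrite big_distrr /=; apply: ler_sum => n _.
set k : R := n.+1%:R; have k0 : 0 <= k by [].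
have h1 : t0 * S n <= k * (q0 / 4) + `|t0| * C.
  apply: (le_trans (ler_norm _)); rewrite normrM.
  apply: (le_trans (ler_wpM2l (normr_ge0 _) (SC n))); rewrite mulrDr lerD2r -/k.
  have := ler_wpM2r k0 td; lra.
have h2 : k ^+ 2 <= 256 / q0 ^+ 2 * expR (k * (q0 / 8)).
  have := @sqr_le_expR R (k * (q0 / 8)); rewrite mulr_ge0 ?divr_ge0 ?(ltW Qt0) // => /(_ isT).
  rewrite exprMn => h; rewrite -(ler_pM2r (_ : 0 < (q0 / 8) ^+ 2)) ?exprn_gt0 ?divr_gt0 //.
  apply: (le_trans h); rewrite le_eqVlt; apply/orP; left; apply/eqP; field.
  by rewrite gt_eqF.
rewrite /B -mulrA -expRD.
apply: (@le_trans _ _ (e n * (256 / q0 ^+ 2 * expR (k * (q0 / 8)) * expR (k * (q0 / 4))))).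
  by rewrite ler_wpM2l ?expR_ge0 // ler_wpM2r ?expR_ge0.
rewrite /e mulrC -!mulrA ler_wpM2l // ler_wpM2l ?invr_ge0 ?sqr_ge0 //.
rewrite -!expRD ler_expR -/k; have := mulr_ge0 k0 (ltW Qt0); rewrite -/q0; lra.
Qed.

Let e_sum_le N : \sum_(n < N) e n <= 2. Proof. exact: partial_gen_Q_le. Qed.

Let e_ge0 n : 0 <= e n. Proof. exact: expR_ge0. Qed.

(** Minimality of [Q t0]: if the sums stayed below [2 - k], the moment bound would allow lowering
    [q0] by [eta] with all sums still at most 2. *)
Lemma e_sum_cvg : (\sum_(n < N) e n) @[N --> \oo] --> (2 : R).
Proof.
have [M M0 HM] := moment_bounded.
apply/cvgrPdist_le => k k0.
suff [N0 HN] : exists N0, 2 - k <= \sum_(n < N0) e n.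
  near=> N; rewrite ger0_norm ?subr_ge0 ?e_sum_le // lerBlDl -lerBlDr.
  apply: (le_trans HN); apply: partial_gen_mono.
  by near: N; exact: nbhs_infty_ge.
apply: contrapT => /forallNP Hk.
pose eta := Num.min (q0 / 4) (k / (M + 1)).
have q40 : 0 < q0 / 4 by rewrite divr_gt0.
have M10 : 0 < M + 1 by rewrite ltr_wpDl.
have eta0 : 0 < eta by rewrite lt_min q40 divr_gt0.
have etaq : eta <= q0 / 4 by rewrite ge_min lexx.
have etaM : eta * M <= k.
  apply: (@le_trans _ _ (k / (M + 1) * M)); first by rewrite ler_wpM2r // ge_min lexx orbT.
  by rewrite mulrAC ler_pdivrMr // ler_pM2l // lerDl.
have : Q t0 <= q0 - eta.
  apply: Q_le; first by rewrite -/q0; lra.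
  move=> N; apply: (@le_trans _ _ (\sum_(n < N) (e n + eta * (e n * (n.+1%:R ^+ 2 * expR (n.+1%:R * (q0 / 4))))))).
    apply: ler_sum => n _.
    have -> : t0 * S n - n.+1%:R * (q0 - eta) = (t0 * S n - n.+1%:R * q0) + n.+1%:R * eta by ring.
    rewrite expRD -/(e n); set x := n.+1%:R * eta.
    have h1 : expR x <= 1 + eta * (n.+1%:R ^+ 2 * expR (n.+1%:R * (q0 / 4))).
      apply: (le_trans (expR_le1Mx x)); rewrite lerD2l /x [n.+1%:R * eta]mulrC -mulrA ler_pM2l //.
      apply: ler_pM => //.
        by rewrite expr2 ler_peMl // ler1n.
      by rewrite ler_expR mulrC ler_wpM2l.
    by have := ler_wpM2l (e_ge0 n) h1; lra.
  rewrite big_split /= -big_distrr /=.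
  have h2 : \sum_(n < N) e n <= 2 - k by rewrite leNgt; apply/negP => /ltW; exact: Hk.
  have := ler_wpM2l (ltW eta0) (HM N); lra.
by rewrite leNgt -/q0 gtrBl eta0.
Unshelve. all: by end_near. Qed.

Lemma S_linear : exists2 A, 0 <= A & forall n, `|S n| <= A * n.+1%:R.
Proof.
have [C C0 SC] := S_sublinear ltr01; exists (1 + C); first by rewrite addr_ge0.
move=> n; apply: (le_trans (SC n)); rewrite mulrDl lerD2l.
by apply: ler_peMr => //; rewrite ler1n.
Qed.

(* Second order expansion of the implicit equation [F(t, Q t) = 2]; the lower
   bound is global because the equation is convex in [(t, q)]. *)
Lemma Q_expansion : exists r, (forall h, q0 + r * h <= Q (t0 + h)) /\
  exists C d, [/\ 0 <= C, 0 < d & forall h, `|h| <= d -> Q (t0 + h) <= q0 + r * h + C * h ^+ 2].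
Proof.
have [M M0 HM] := moment_bounded; have [A A0 SA] := S_linear.
have m1 N (f : nat -> R) B : 0 <= B -> (forall n, `|f n| <= B * n.+1%:R) -> \sum_(n < N) `|f n * e n| <= B * M.
  move=> B0 fB; apply: le_trans (ler_wpM2l B0 (HM N)).
  rewrite big_distrr /=; apply: ler_sum => n _.
  rewrite normrM (ger0_norm (e_ge0 n)) mulrC mulrCA; apply: ler_wpM2l => //.
  apply: (le_trans (fB n)); apply: ler_wpM2l => //.
  rewrite expr2 -mulrA; apply: ler_peMr => //.
  apply: mulr_ege1; first by rewrite ler1n.
  by rewrite -expR0 ler_expR mulr_ge0 // divr_ge0 // ltW.
have [Nt cN] : exists l : R, (\sum_(n < N) S n * e n) @[N --> \oo] --> l.
  apply: (@bounded_sum_cvg _ (fun n => S n * e n) (A * M)) => N; exact: m1.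
have [D cD] : exists l : R, (\sum_(n < N) n.+1%:R * e n) @[N --> \oo] --> l.
  apply: (@bounded_sum_cvg _ (fun n => n.+1%:R * e n) (1 * M)) => N.
  apply: (m1 N (fun n => n.+1%:R) 1) => // n.
  by rewrite mul1r normr_nat.
have D0 : 0 < D.
  apply: (@lt_le_trans _ _ (e 0)); first exact: expR_gt0.
  apply: (cvgr_to_ge cD); near=> N.
  have N0 : (0 < N)%N by near: N; exact: nbhs_infty_gt.
  rewrite -(prednK N0) big_ord_recl /= mul1r lerDl sumr_ge0 // => n _.
  by rewrite mulr_ge0.
(* Implicit differentiation of the generating sum at [(t0, q0)]. *)
pose r := Nt / D.
have lin h k : (\sum_(n < N) e n * (1 + (S n * h - n.+1%:R * k))) @[N --> \oo] --> 2 + (h * Nt - k * D).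
  have -> : (fun N => \sum_(n < N) e n * (1 + (S n * h - n.+1%:R * k))) =
      (fun N => \sum_(n < N) e n + (h * \sum_(n < N) S n * e n - k * \sum_(n < N) n.+1%:R * e n)).
    apply/funext => N; rewrite !big_distrr /= -sumrB -big_split /=.
    by apply: eq_bigr => n _; ring.
  by apply: cvgD; [exact: e_sum_cvg|apply: cvgB; apply: cvgM => //; exact: cvg_cst].
have rD : r * D = Nt by rewrite /r divfK // gt_eqF.
have genE N h k : F N (t0 + h) (q0 + k) = \sum_(n < N) e n * expR (S n * h - n.+1%:R * k).
  by apply: eq_bigr => n _; rewrite -expRD; congr expR; ring.
exists r; split.
  move=> h; apply/ler_addgt0Pr => eta eta0; rewrite -lerBlDr.
  (* Lowering [q] by [eta] multiplies every term by at least [expR eta], which makes up for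
     truncating the series. *)
  have c2 : 2 * expR (- eta) < 2 by rewrite gtr_pMr // expR_lt1 oppr_lt0.
  have := lin h (r * h); rewrite (_ : h * Nt - r * h * D = 0); last by rewrite -rD; ring.
  rewrite addr0 => /cvgr_ge /(_ _ c2) [N _ /(_ N (leqnn N))] /= h1.
  apply: (@Q_ge _ _ N); rewrite -addrA genE.
  apply: (@le_trans _ _ (expR eta * \sum_(n < N) e n * (1 + (S n * h - n.+1%:R * (r * h))))).
    by rewrite mulrC -ler_pdivrMr ?expR_gt0 // -expRN.
  rewrite big_distrr /=; apply: ler_sum => n _.
  rewrite mulrCA; apply: ler_wpM2l => //.
  apply: (@le_trans _ _ (expR eta * expR (S n * h - n.+1%:R * (r * h)))).
    by apply: ler_wpM2l; [exact: expR_ge0|exact: expR_ge1Dx].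
  rewrite -expRD ler_expR.
  have : eta <= n.+1%:R * eta by apply: ler_peMl; [exact: ltW|rewrite ler1n].
  lra.
pose z := A + `|r| + 1.
have r0 := normr_ge0 r.
have z0 : 0 < z by rewrite /z; lra.
(* With this choice the linear gain [C * h ^+ 2 * D] cancels the Taylor remainder exactly; see
   [lim2]. *)
pose C := z ^+ 2 * M / D.
have C0 : 0 <= C by rewrite divr_ge0 ?mulr_ge0 ?sqr_ge0 // ltW.
have q40 : 0 < q0 / 4 by rewrite divr_gt0.
exists C, (Num.min (C + 1)^-1 (q0 / 4 / z)); split => //.
  by rewrite lt_min invr_gt0 ltr_wpDl // divr_gt0.
move=> h; rewrite le_min => /andP[h1 h2].
have h0 := normr_ge0 h.
have Ch1 : C * `|h| <= 1.
  have := ler_wpM2l C0 h1; move/le_trans; apply.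
  by rewrite ler_pdivrMr ?ltr_wpDl // mul1r lerDl.
have hz : `|h| * z <= q0 / 4 by rewrite -ler_pdivlMr.
have hh : h ^+ 2 = `|h| ^+ 2 by rewrite real_normK ?num_real.
have rh : `|r * h| <= `|r| * `|h| by rewrite normrM.
have Chh : C * h ^+ 2 <= `|h|.
  by rewrite hh expr2 mulrA; have := ler_wpM2r h0 Ch1; rewrite mul1r.
have Chh0 : 0 <= C * h ^+ 2 by rewrite mulr_ge0 ?sqr_ge0.
rewrite -addrA; apply: Q_le.
  move: rh; rewrite ler_norml => /andP[k1 k2].
  have : `|h| * z = `|h| * A + `|h| * `|r| + `|h| by rewrite /z; ring.
  have := mulr_ge0 h0 A0; rewrite -/q0; lra.
move=> N; rewrite genE.
have bnd N' : \sum_(n < N') e n * expR (S n * h - n.+1%:R * (r * h + C * h ^+ 2)) <=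
    \sum_(n < N') e n * (1 + (S n * h - n.+1%:R * (r * h + C * h ^+ 2))) + `|h| ^+ 2 * z ^+ 2 * M.
  apply: (@le_trans _ _ (\sum_(n < N') e n * (1 + (S n * h - n.+1%:R * (r * h + C * h ^+ 2))) +
    `|h| ^+ 2 * z ^+ 2 * \sum_(n < N') e n * (n.+1%:R ^+ 2 * expR (n.+1%:R * (q0 / 4))))); last first.
    by rewrite lerD2l; apply: ler_wpM2l => //; rewrite mulr_ge0 ?sqr_ge0.
  rewrite big_distrr /= -big_split /=; apply: ler_sum => n _.
  set y := S n * h - _; set k : R := n.+1%:R; have k0 : 0 <= k by [].
  have yz : `|y| <= k * (`|h| * z).
    rewrite /y -/k; apply: (le_trans (ler_normB _ _)); rewrite !normrM (ger0_norm k0).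
    have := ler_wpM2r h0 (SA n); rewrite -/k => j1.
    have j2 : `|r * h + C * h ^+ 2| <= `|r| * `|h| + `|h|.
      by apply: (le_trans (ler_normD _ _)); apply: lerD => //; rewrite ger0_norm.
    by have := ler_wpM2l k0 j2; rewrite /z; lra.
  have y2 : y ^+ 2 <= `|h| ^+ 2 * z ^+ 2 * k ^+ 2.
    have -> : y ^+ 2 = `|y| ^+ 2 by rewrite real_normK ?num_real.
    have -> : `|h| ^+ 2 * z ^+ 2 * k ^+ 2 = (k * (`|h| * z)) ^+ 2 by ring.
    by rewrite ler_pXn2r ?nnegrE // mulr_ge0 // mulr_ge0 // ltW.
  have ey : expR `|y| <= expR (k * (q0 / 4)).
    by rewrite ler_expR (le_trans yz) // ler_wpM2l.
  have ty := expR_taylor2_le y.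
  have : y ^+ 2 * expR `|y| <= `|h| ^+ 2 * z ^+ 2 * k ^+ 2 * expR (k * (q0 / 4)).
    by apply: ler_pM => //; first exact: sqr_ge0.
  move=> j3; have j4 : expR y <= 1 + y + `|h| ^+ 2 * z ^+ 2 * k ^+ 2 * expR (k * (q0 / 4)) by lra.
  by have := ler_wpM2l (e_ge0 n) j4; lra.
have lim2 : 2 + (h * Nt - (r * h + C * h ^+ 2) * D) + `|h| ^+ 2 * z ^+ 2 * M = 2.
  by rewrite -hh -rD /C; field; rewrite gt_eqF.
rewrite -lim2; apply: (cvgr_to_ge (cvgD (lin h (r * h + C * h ^+ 2)) (cvg_cst _))).
near=> N'; apply: le_trans (bnd N').
have NN' : (N <= N')%N by near: N'; exact: nbhs_infty_ge.
by rewrite -!genE; exact: partial_gen_mono.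
Unshelve. all: by end_near. Qed.

(** The global supporting line is part of the conclusion because it is the form in which convexity
    is used afterwards. *)
Lemma Q_derivable : exists r, [/\ derivable Q t0 1, derive1 Q t0 = r & forall h, q0 + r * h <= Q (t0 + h)].
Proof.
have [r [lo [C [d [C0 d0 up]]]]] := Q_expansion; exists r.
suff [] : derivable Q t0 1 /\ derive1 Q t0 = r by [].
apply: derivable_squeeze => k k0.
have C10 : 0 < C + 1 by rewrite ltr_wpDl.
exists (Num.min d (k / (C + 1))); first by rewrite lt_min d0 divr_gt0.
move=> h; rewrite le_min => /andP[h1 h2]; rewrite -/q0.
have := lo h; have := up h h1 => u l.
have hh : C * h ^+ 2 <= k * `|h|.
  have -> : h ^+ 2 = `|h| ^+ 2 by rewrite real_normK ?num_real.
  rewrite expr2 mulrA ler_wpM2r //.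
  apply: (@le_trans _ _ ((C + 1) * `|h|)); first by rewrite ler_wpM2r // lerDl.
  by rewrite mulrC -ler_pdivlMr.
by rewrite ler_norml; apply/andP; split; lra.
Qed.

End at_point.
End implicit_function.

(** * Phase transitions *)

Section phase_transition.
Context {R : realType} (S : nat -> R) (Q : R -> R).
Local Notation F := (partial_gen S).

Hypothesis S_sublinear : forall d, 0 < d -> exists2 C, 0 <= C & forall n, `|S n| <= d * n.+1%:R + C.
Hypothesis Q_ge0 : forall t, 0 <= Q t.
Hypothesis Q_le : forall t q, 0 <= q -> (forall N, F N t q <= 2) -> Q t <= q.
Hypothesis Q_ge : forall t q N, 2 <= F N t q -> q <= Q t.

Hypothesis expS_le : forall N, \sum_(n < N) expR (S n) <= 2.
Hypothesis expS_cvg : (\sum_(n < N) expR (S n)) @[N --> \oo] --> (2 : R).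
Hypothesis S_le0 : forall n, (0 < n)%N -> S n <= 0.
Hypothesis S01 : expR (S 0) * S 0 + expR (S 1) * S 1 < 0.

(** Only [S 0] can be positive, and the term of [S 1] outweighs it. Thus [sig] bounds minus the
    t-derivative of the generating sum at (1, 0) from below, for every truncation with at least two
    terms. *)
Let sig := - (expR (S 0) * S 0 + expR (S 1) * S 1).
Let sig0 : 0 < sig. Proof. by rewrite oppr_gt0. Qed.

Lemma partial_gen1 N : F N 1 0 = \sum_(n < N) expR (S n).
Proof. by apply: eq_bigr => n _; rewrite mul1r mulr0 subr0. Qed.

Lemma partial_gen0_Q t : (forall N, F N t 0 <= 2) -> Q t = 0.
Proof. by move=> h; apply/eqP; rewrite eq_le Q_ge0 andbT; exact: Q_le. Qed.

Lemma Q1 : Q 1 = 0.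
Proof. by apply: partial_gen0_Q => N; rewrite partial_gen1. Qed.

Lemma sum_expS_S N : sig <= \sum_(n < N.+2) expR (S n) * - S n.
Proof.
rewrite big_ord_recl big_ord_recl /= addrA /sig opprD !mulrN lerDl.
apply: sumr_ge0 => n _; rewrite mulr_ge0 ?expR_ge0 // oppr_ge0; exact: S_le0.
Qed.

(** The tangent plane at (1, 0) of a convex function of [(t, q)]. *)
Lemma partial_gen_ge_left N h k : \sum_(n < N) expR (S n) +
    (h * (\sum_(n < N) expR (S n) * - S n) - k * \sum_(n < N) n.+1%:R * expR (S n))
  <= F N (1 - h) k.
Proof.
rewrite !big_distrr /= -sumrB -big_split /=; apply: ler_sum => n _.
have -> : (1 - h) * S n - n.+1%:R * k = S n + (- h * S n - n.+1%:R * k) by ring.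
rewrite expRD; have := ler_wpM2l (expR_ge0 (S n)) (expR_ge1Dx (- h * S n - n.+1%:R * k)); lra.
Qed.

Lemma Q_gt0_left t : t < 1 -> 0 < Q t.
Proof.
move=> t1; pose h := 1 - t; have h0 : 0 < h by rewrite subr_gt0.
have hs0 : 0 < h * sig by exact: mulr_gt0.
(* The sum at t = 1 is within [h * sig] of 2, and moving to the left gains at least [h * sig]. *)
have /cvgr_gt /(_ (2 - h * sig)) := expS_cvg; rewrite gtrBl hs0 => /(_ isT) [N _ HN].
apply: (@Q_gt R S Q Q_ge N.+2).
have -> : t = 1 - h by rewrite /h; ring.
apply: lt_le_trans (partial_gen_ge_left _ _ _); rewrite mul0r subr0.
have := HN N.+2 (leqW (leqnSn N)); rewrite /=.
have := ler_wpM2l (ltW h0) (sum_expS_S N); lra.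
Qed.

Lemma Q_derivable_left t : t < 1 -> exists r, [/\ derivable Q t 1, derive1 Q t = r,
  r < 0 & forall h, Q t + r * h <= Q (t + h)].
Proof.
move=> t1; have Qt0 := Q_gt0_left t1.
have [r [dQ Qr lo]] := Q_derivable S_sublinear Q_le Q_ge Qt0.
exists r; split => //.
(* The supporting line at [t] lies below [Q 1 = 0], whereas [Q t > 0]; hence its slope is
   negative. *)
have := lo (1 - t); rewrite (_ : t + (1 - t) = 1) ?Q1; last by ring.
move=> h.
rewrite ltNge; apply/negP => r0.
by have := mulr_ge0 r0 (_ : 0 <= 1 - t); rewrite subr_ge0 ltW // => /(_ isT); lra.
Qed.

(** Chord slopes at 1 are monotone: compare the supporting line at [1 + k] with the values at 1 and
    at [1 + h]. *)
Lemma Q_slope_left h k : h < k -> k < 0 -> Q (1 + h) / h <= Q (1 + k) / k.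
Proof.
move=> hk k0; have k1 : 1 + k < 1 by lra.
have [r [_ _ _ lo]] := Q_derivable_left k1.
have := lo (- k); rewrite (_ : 1 + k + - k = 1); last by ring.
have := lo (h - k); rewrite (_ : 1 + k + (h - k) = 1 + h); last by ring.
rewrite Q1 => l1 l2.
have h0 : h < 0 by exact: lt_trans k0.
rewrite ler_ndivrMr // mulrAC ler_ndivrMr //.
have := ler_wnM2l (ltW k0) l1.
have := ler_wpM2l (_ : 0 <= k - h) l2; rewrite subr_ge0 ltW // => /(_ isT); nra.
Qed.

(** With a finite first moment, the tangent plane bounds [Q (1 + h)] below by a positive multiple of
    [- h]; half of the gain [sig] pays for truncation. Monotone chord slopes then have a limit,
    bounded away from 0. *)
Lemma left_derivative (Dm : R) : (forall N, \sum_(n < N) n.+1%:R * expR (S n) <= Dm) ->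
  exists2 l, (h^-1 * (Q (1 + h) - Q 1)) @[h --> 0^'-] --> l & l < 0.
Proof.
move=> HD; have Dm0 : 0 < Dm.
  apply: lt_le_trans (HD 1%N); rewrite big_ord1 mul1r; exact: expR_gt0.
pose dl := sig / (2 * Dm); have dl0 : 0 < dl by rewrite divr_gt0 // mulr_gt0.
have Qlow h : h < 0 -> h^-1 * (Q (1 + h) - Q 1) <= - dl.
  move=> h0; have hN : 0 < - h by lra.
  rewrite Q1 subr0 ler_ndivrMl // mulrN -mulNr.
  have hs0 : 0 < (- h) * sig / 2 by rewrite divr_gt0 // mulr_gt0.
  have /cvgr_gt /(_ (2 - (- h) * sig / 2)) := expS_cvg; rewrite gtrBl hs0 => /(_ isT) [N _ HN].
  apply: (@Q_ge _ _ N.+2); rewrite -[h in 1 + h]opprK.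
  apply: le_trans (partial_gen_ge_left _ _ _).
  have := HN N.+2 (leqW (leqnSn N)); rewrite /=.
  have := ler_wpM2l (ltW hN) (sum_expS_S N).
  have := ler_wpM2l (ltW (mulr_gt0 hN dl0)) (HD N.+2).
  have : - h * dl * Dm = - h * sig / 2 by rewrite /dl; field; rewrite gt_eqF.
  lra.
have cv : cvg ((h^-1 * (Q (1 + h) - Q 1)) @[h --> 0^'-]).
  apply: nondecreasing_at_left_is_cvgr.
    near=> x => h k; rewrite !in_itv /= => /andP[_ h0] /andP[_ k0].
    rewrite le_eqVlt => /predU1P[->//|hk].
    by rewrite Q1 !subr0 ![_^-1 * _]mulrC; exact: Q_slope_left.
  near=> x; exists (- dl) => _ [h /= + <-]; rewrite in_itv /= => /andP[_ h0].
  exact: Qlow.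
exists (lim ((h^-1 * (Q (1 + h) - Q 1)) @[h --> 0^'-])) => //.
apply: (@le_lt_trans _ _ (- dl)); last by rewrite oppr_lt0.
apply: limr_le => //; near=> h; apply: Qlow; near: h; exact: nbhs_left_lt.
Unshelve. all: by end_near. Qed.

Lemma Q0_right t : S 0 <= 0 -> 1 <= t -> Q t = 0.
Proof.
move=> S0 t1; apply: partial_gen0_Q => N; apply: le_trans (expS_le N).
apply: ler_sum => n _; rewrite mulr0 subr0 ler_expR.
have Sn : S n <= 0 by case: (posnP n) => [->//|]; exact: S_le0.
nra.
Qed.

(** Convexity in [t] at q = 0, from the tangents of the exponentials at the intermediate point. *)
Lemma partial_gen_between N t t' : 1 <= t -> t <= t' -> F N 1 0 <= 2 -> F N t' 0 <= 2 ->
  F N t 0 <= 2.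
Proof.
move=> t1 tt' F1 F2; have [t't|] := leP t' 1.
  by rewrite (_ : t = 1) //; apply/eqP; rewrite eq_le t1 (le_trans tt').
move=> t'1; have tp : 0 < t' - 1 by rewrite subr_gt0.
rewrite -(ler_pM2l tp); apply: (@le_trans _ _ ((t' - t) * F N 1 0 + (t - 1) * F N t' 0)).
  rewrite /partial_gen !big_distrr /= -big_split /=; apply: ler_sum => n _.
  rewrite !mulr0 !subr0 mul1r.
  have e1 : expR (t * S n) * (1 + (1 - t) * S n) <= expR (S n).
    rewrite [leRHS](_ : _ = expR (t * S n) * expR ((1 - t) * S n)); last by rewrite -expRD; congr expR; ring.
    by apply: ler_wpM2l; [exact: expR_ge0|exact: expR_ge1Dx].
  have e2 : expR (t * S n) * (1 + (t' - t) * S n) <= expR (t' * S n).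
    rewrite [leRHS](_ : _ = expR (t * S n) * expR ((t' - t) * S n)); last by rewrite -expRD; congr expR; ring.
    by apply: ler_wpM2l; [exact: expR_ge0|exact: expR_ge1Dx].
  have a1 : 0 <= t' - t by lra. have a2 : 0 <= t - 1 by lra.
  by have := ler_wpM2l a1 e1; have := ler_wpM2l a2 e2; lra.
have a1 : 0 <= t' - t by lra. have a2 : 0 <= t - 1 by lra.
by have := ler_wpM2l a1 F1; have := ler_wpM2l a2 F2; lra.
Qed.

(** The point [t1] is the supremum of the parameters whose sums are all at most 2. It exceeds 1
    because the sum of the first two terms decreases initially while the other terms do not
    increase; it is finite because the term of [S 0 > 0] alone eventually exceeds 2. *)
Lemma Q0_right_interval : 0 < S 0 -> exists2 t1, 1 < t1 &
  (forall t, 1 <= t <= t1 -> Q t = 0) /\ (forall t, t1 < t -> 0 < Q t).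
Proof.
move=> S0.
pose K := [set t : R | 1 <= t /\ forall N, F N t 0 <= 2].
have K1 : K 1 by split => // N; rewrite partial_gen1.
have [tau tau1 Ktau] : exists2 tau, 1 < tau & K tau.
  pose B := expR (S 0) * (S 0 ^+ 2 * expR `|S 0|) + expR (S 1) * (S 1 ^+ 2 * expR `|S 1|).
  have B0 : 0 <= B by rewrite addr_ge0 // mulr_ge0 ?expR_ge0 // mulr_ge0 ?sqr_ge0 ?expR_ge0.
  (* Small enough for the quadratic error [h * h * B] to be covered by the first-order decrease
     [h * sig]. *)
  pose h := Num.min 1 (sig / (B + 1)).
  have B1 : 0 < B + 1 by rewrite ltr_wpDl.
  have h0 : 0 < h by rewrite lt_min ltr01 divr_gt0.
  have h1 : h <= 1 by rewrite ge_min lexx.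
  have hB : h * B <= sig.
    apply: (@le_trans _ _ (sig / (B + 1) * B)); first by rewrite ler_wpM2r // ge_min lexx orbT.
    by rewrite mulrAC ler_pdivrMr // ler_pM2l // lerDl.
  have ex x : expR x * expR (h * x) <= expR x + h * (expR x * x) + h * h * (expR x * (x ^+ 2 * expR `|x|)).
    have e1 := expR_taylor2_le (h * x).
    have e2 : expR `|h * x| <= expR `|x|.
      by rewrite ler_expR normrM (gtr0_norm h0) ler_piMl.
    have := ler_wpM2l (sqr_ge0 (h * x)) e2 => e3.
    have e4 : expR (h * x) <= 1 + h * x + h * h * (x ^+ 2 * expR `|x|).
      have : (h * x) ^+ 2 * expR `|x| = h * h * (x ^+ 2 * expR `|x|) by ring.
      lra.
    by have := ler_wpM2l (expR_ge0 x) e4; lra.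
  exists (1 + h); first by rewrite ltrDl.
  split=> [|N]; first by rewrite lerDl ltW.
  apply: le_trans (partial_gen_mono S _ _ (leqW (leqnSn N))) _.
  apply: le_trans (expS_le N.+2).
  rewrite /partial_gen big_ord_recl big_ord_recl [leRHS]big_ord_recl [X in _ <= _ + X]big_ord_recl /= !addrA.
  apply: lerD; last first.
    apply: ler_sum => n _; rewrite ler_expR mulr0 subr0.
    have : S (lift ord0 (lift ord0 n)) <= 0 by exact: S_le0.
    by move: (S _) => s s0; nra.
  rewrite !mulr0 !subr0 !mulrDl !mul1r !expRD.
  have := ex (S 0); have := ex (S 1).
  have := ler_wpM2l (ltW h0) hB; rewrite /B /sig; nra.
have bK : has_ubound K.
  exists (2 / S 0) => t [t1 /(_ 1%N)]; rewrite /partial_gen big_ord1 mulr0 subr0 => h.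
  rewrite ler_pdivlMr // (le_trans _ h) //.
  by have := expR_ge1Dx (t * S 0); lra.
have hsK : has_sup K by split => //; exists 1.
exists (sup K); first by apply: (lt_le_trans tau1); exact: ub_le_sup.
split.
  move=> t /andP[t1 tK]; apply: partial_gen0_Q => N; rewrite leNgt; apply/negP => Ft.
  pose A := \sum_(n < N) `|S n|.
  have A0 : 0 <= A by exact: sumr_ge0.
  have A1 : 0 < A + 1 by rewrite ltr_wpDl.
  (* A step to the left shorter than [eta] keeps the sum above 2. This contradicts membership of
     [t'] and covers the endpoint [sup K]. *)
  pose eta := ln (F N t 0 / 2) / (A + 1).
  have F20 : 0 < F N t 0 / 2 by rewrite divr_gt0 // (lt_trans _ Ft).
  have eta0 : 0 < eta by rewrite divr_gt0 // ln_gt0 // ltr_pdivlMr // mul1r.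
  have [t' [t'1 t'K] tt'] := sup_adherent eta0 hsK.
  have [le_tt'|lt_t't] := leP t t'.
    have : F N t 0 <= 2.
      by apply: (partial_gen_between t1 le_tt'); rewrite ?partial_gen1.
    by rewrite leNgt Ft.
  suff : 2 < F N t' 0 by rewrite ltNge t'K.
  apply: (@lt_le_trans _ _ (expR (- (eta * A)) * F N t 0)).
    have -> : 2 = expR (- (eta * (A + 1))) * F N t 0.
      rewrite /eta divfK ?gt_eqF // expRN lnK ?posrE // invf_div divfK // gt_eqF //.
      exact: lt_trans Ft.
    rewrite ltr_pM2r; last exact: lt_trans Ft.
    by rewrite ltr_expR ltrN2 ltr_pM2l // ltrDl.
  rewrite /partial_gen big_distrr /=; apply: ler_sum => n _.
  rewrite -expRD ler_expR !mulr0 !subr0.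
  have SA : `|S n| <= A by rewrite /A (bigD1 n) //= lerDl sumr_ge0.
  have h1 : (t - t') * S n <= (t - t') * A.
    by rewrite ler_wpM2l ?subr_ge0 ?(ltW lt_t't) // (le_trans (ler_norm _)).
  have h2 : (t - t') * A <= eta * A by rewrite ler_wpM2r //; lra.
  lra.
move=> t Kt.
have t1 : 1 <= t by rewrite (le_trans _ (ltW Kt)) //; exact: ub_le_sup.
have : ~ K t by move=> /(ub_le_sup bK); rewrite leNgt Kt.
move=> /not_andP[//|/existsNP[N /negP]]; rewrite -ltNge; exact: Q_gt.
Qed.

(** * Smooth contact at t = 1 under infinite mean return time *)

Section differentiable_transition.
Hypothesis S_div : forall B, exists m, B <= \sum_(n < m) n.+1%:R * expR (S n).

(** Along the ray [(1 - h, dl * h)] the exponent of term [n] changes by [h * c n]. Late [c n] are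
    nonpositive, and divergence of the first moment makes the weighted sum of the early ones at most
    -1, so for small [h] the sums do not exceed 2. *)
Lemma Q_small_left dl : 0 < dl -> exists2 d, 0 < d &
  forall h, 0 <= h <= d -> Q (1 - h) <= dl * h.
Proof.
move=> dl0; have dl20 : 0 < dl / 2 by rewrite divr_gt0.
have [C C0 SC] := S_sublinear dl20.
pose c n := - S n - n.+1%:R * dl.
have cC n : c n <= C - dl / 2 * n.+1%:R.
  by have := SC n; rewrite ler_norml /c => /andP[k1 k2]; lra.
(* Since the weights total at most 2, this threshold leaves [2 * C - (2 * C + 1)], that is -1, in
   [bc]. *)
have [m1 Hm1] := S_div (2 / dl * (2 * C + 1)).
have [m2 _ /(_ m2 (leqnn m2)) Hm2] := near_le_natM C dl20.
pose m := (m1 + m2)%N.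
have c_le0 n : (m <= n)%N -> c n <= 0.
  move=> mn; apply: (le_trans (cC n)); rewrite subr_le0 (le_trans Hm2) //.
  rewrite ler_pM2l // ler_nat (leq_trans _ (leqnSn n)) // (leq_trans _ mn) //.
  exact: leq_addl.
have Hm : 2 / dl * (2 * C + 1) <= \sum_(n < m) n.+1%:R * expR (S n).
  apply: (le_trans Hm1); rewrite /m big_split_ord /= lerDl.
  by apply: sumr_ge0 => n _; rewrite mulr_ge0 ?expR_ge0.
clearbody m.
have bc : \sum_(n < m) expR (S n) * c n <= - 1.
  apply: (@le_trans _ _ (C * \sum_(n < m) expR (S n) - dl / 2 * \sum_(n < m) n.+1%:R * expR (S n))).
    rewrite !big_distrr /= -sumrB; apply: ler_sum => n _.
    by have := ler_wpM2l (expR_ge0 (S n)) (cC n); lra.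
  have := ler_wpM2l C0 (expS_le m); have := ler_wpM2l (ltW dl20) Hm.
  have -> : dl / 2 * (2 / dl * (2 * C + 1)) = 2 * C + 1 by field; rewrite gt_eqF.
  lra.
pose B := \sum_(n < m) expR (S n) * (c n ^+ 2 * expR `|c n|).
have B0 : 0 <= B.
  by apply: sumr_ge0 => n _; rewrite mulr_ge0 ?expR_ge0 // mulr_ge0 ?expR_ge0 ?sqr_ge0.
have B1 : 0 < B + 1 by rewrite ltr_wpDl.
exists (Num.min 1 (B + 1)^-1); first by rewrite lt_min ltr01 invr_gt0 B1.
move=> h /andP[h0]; rewrite le_min => /andP[h1 hB].
have hB1 : h * B <= 1.
  apply: (@le_trans _ _ ((B + 1)^-1 * (B + 1))); last by rewrite mulVf // gt_eqF.
  by apply: ler_pM => //; rewrite lerDl.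
have hhB : h * h * B <= h by have := ler_wpM2l h0 hB1; lra.
apply: Q_le; first by rewrite mulr_ge0 // ltW.
move=> N; apply: le_trans (partial_gen_mono S _ _ (leq_addl m N)) _.
have FE N' : F N' (1 - h) (dl * h) = \sum_(n < N') expR (S n) * expR (h * c n).
  by apply: eq_bigr => n _; rewrite -expRD; congr expR; rewrite /c; ring.
rewrite FE; apply: le_trans (expS_le (m + N)).
rewrite !big_split_ord /=; apply: lerD; last first.
  apply: ler_sum => n _; apply: ler_piMr; first exact: expR_ge0.
  by rewrite -expR0 ler_expR mulr_ge0_le0 // c_le0 // leq_addr.
rewrite -subr_le0 -sumrB.
apply: (@le_trans _ _ (h * \sum_(n < m) expR (S n) * c n + h * h * B)).
  rewrite /B !big_distrr /= -big_split /=; apply: ler_sum => n _.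
  have e1 := expR_taylor2_le (h * c n).
  have e2 : expR `|h * c n| <= expR `|c n|.
    by rewrite ler_expR normrM (ger0_norm h0) ler_piMl.
  have := ler_wpM2l (sqr_ge0 (h * c n)) e2 => e3.
  have e4 : expR (h * c n) <= 1 + h * c n + h * h * (c n ^+ 2 * expR `|c n|).
    have : (h * c n) ^+ 2 * expR `|c n| = h * h * (c n ^+ 2 * expR `|c n|) by ring.
    lra.
  by have := ler_wpM2l (expR_ge0 (S n)) e4; lra.
by have := ler_wpM2l h0 bc; lra.
Qed.

Variable t1 : R.
Hypotheses (t1_gt1 : 1 < t1) (Q0 : forall t, 1 <= t <= t1 -> Q t = 0).

Lemma Q_derivable1 : derivable Q 1 1 /\ derive1 Q 1 = 0.
Proof.
apply: derivable_squeeze => e e0; have [d d0 Hd] := Q_small_left e0.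
exists (Num.min d (t1 - 1)); first by rewrite lt_min d0 subr_gt0.
move=> h; rewrite le_min => /andP[h1 h2]; rewrite Q1 mul0r !subr0.
have [h0|h0] := leP 0 h.
  rewrite ger0_norm // in h2; rewrite Q0 ?normr0 ?mulr_ge0 ?(ltW e0) //.
  by apply/andP; split; lra.
rewrite ltr0_norm // in h1 *; rewrite ger0_norm; last exact: Q_ge0.
by rewrite -[h in 1 + h]opprK; apply: Hd; apply/andP; split; lra.
Qed.

Lemma Q_derivable_flat t : 1 < t < t1 -> derivable Q t 1 /\ derive1 Q t = 0.
Proof.
move=> /andP[h1 h2]; apply: derivable_squeeze => e e0.
exists (Num.min (t - 1) (t1 - t)); first by rewrite lt_min !subr_gt0 h1 h2.
move=> h; rewrite le_min => /andP[k1 k2].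
move: k1 k2; rewrite !ler_norml => /andP[k1 k2] /andP[k3 k4].
have -> : Q (t + h) = 0 by apply: Q0; apply/andP; split; lra.
have -> : Q t = 0 by apply: Q0; apply/andP; split; exact: ltW.
by rewrite mul0r !subr0 oppr_le0 andbb mulr_ge0 // ltW.
Qed.

Lemma Q_C1_at1 : C1_at Q 1.
Proof.
split.
  near=> t; have [tl|tg|E] := ltgtP t 1; last by rewrite E; case: Q_derivable1.
    by have [r []] := Q_derivable_left tl.
  suff : 1 < t < t1 by move=> /Q_derivable_flat[].
  by rewrite tg /=; near: t; exact: lt_nbhsl.
rewrite /prop_for /continuous_at (proj2 Q_derivable1).
apply/cvgrPdist_le => e e0; have e20 : 0 < e / 2 by rewrite divr_gt0.
have [d d0 Hd] := Q_small_left e20.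
near=> t; rewrite sub0r normrN.
have [tl|tg|->] := ltgtP t 1; last by rewrite (proj2 Q_derivable1) normr0 ltW.
  have [r [_ -> r0 lo]] := Q_derivable_left tl.
  rewrite ltr0_norm //.
  have td : 1 - d / 2 < t by near: t; apply: lt_nbhsr; rewrite gtrBl divr_gt0.
  (* The supporting line at [t] is evaluated at the reflected point [2 * t - 1]: the small value of
     [Q] there bounds the size of the slope. *)
  have := Hd (2 * (1 - t)) (_ : 0 <= 2 * (1 - t) <= d).
  have := lo (t - 1); rewrite (_ : t + (t - 1) = 1 - 2 * (1 - t)); last by ring.
  have := Q_ge0 t => q0 l1 /(_ _) l2.
  have {}l2 : Q (1 - 2 * (1 - t)) <= e / 2 * (2 * (1 - t)) by apply: l2; apply/andP; split; lra.
  have tp : 0 < 1 - t by lra.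
  by rewrite -(ler_pM2r tp); lra.
rewrite (proj2 (@Q_derivable_flat t _)) ?normr0 ?ltW // tg /=.
near: t; exact: lt_nbhsl.
Unshelve. all: by end_near. Qed.

End differentiable_transition.

End phase_transition.

(** * The pressure function of a grid function *)

Section pressure_excess.
Context {R : realType} (a : nat -> R).
Hypothesis a0 : a n @[n --> \oo] --> (0 : R).
Let S n : R := \sum_(k < n.+1) a k.
Local Notation scaled_pressure t :=
  (pressure bshift (fun x : borel_Sigma3 => (t * grid_function a x)%R)).

Lemma sum_sublinear d : 0 < d -> exists2 C, 0 <= C & forall n, `|S n| <= d * n.+1%:R + C.
Proof.
move=> d0; have [K K0 aK] := grid_bounded a0.
have /cvgrPdist_le /(_ _ d0) [J _ aJ] := a0.
exists (K * J%:R) => [|n]; first exact: mulr_ge0.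
suff H m : `|\sum_(k < m) a k| <= d * m%:R + K * (minn m J)%:R.
  by apply: (le_trans (H _)); rewrite lerD2l ler_wpM2l // ler_nat geq_minr.
elim: m => [|m IH]; first by rewrite big_ord0 normr0 mulr0 add0r mulr_ge0.
rewrite big_ord_recr /=; apply: le_trans (ler_normD _ _) _; rewrite -natr1.
have [mJ|Jm] : (m < J)%N \/ (J <= m)%N by lia.
  rewrite (minn_idPl mJ); rewrite (minn_idPl (ltnW mJ)) in IH.
  rewrite -natr1; have := aK m; lra.
have := aJ m Jm; rewrite /= sub0r normrN (minn_idPr (leqW Jm)).
rewrite (minn_idPr Jm) in IH; lra.
Qed.

Lemma cvg_scaled t : t * a n @[n --> \oo] --> (0 : R).
Proof. by rewrite -(mulr0 t); apply: cvgM => //; exact: cvg_cst. Qed.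

Lemma grid_functionZ t (x : Sigma3) : t * grid_function a x = grid_function (fun n => t * a n) x.
Proof.
case: (visit_or_no2 x) => [[n xn]|xn]; first by rewrite !(grid_function_visit _ xn).
by rewrite !grid_function_no2 // mulr0.
Qed.

Lemma sum_scaled t n : \sum_(k < n.+1) t * a k = t * S n.
Proof. by rewrite big_distrr. Qed.

Lemma scaled_pressure_le t q : 0 <= q -> (forall N, partial_gen S N t q <= 2) ->
  (scaled_pressure t <= (ln 2 + q)%:E)%E.
Proof.
move=> q0 h; rewrite (funext (grid_functionZ t)); apply: pressure_le => //.
  exact: cvg_scaled.
by move=> N; under eq_bigr do rewrite sum_scaled; exact: h.
Qed.

Lemma scaled_pressure_ge t q N : 2 <= partial_gen S N t q ->
  ((ln 2 + q)%:E <= scaled_pressure t)%E.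
Proof.
case: N => [|N h]; first by rewrite /partial_gen big_ord0 leNgt ltr0n.
rewrite (funext (grid_functionZ t)); apply: (pressure_ge (N := N)); first exact: cvg_scaled.
by under eq_bigr do rewrite sum_scaled.
Qed.

Lemma scaled_sublinear t d : 0 < d -> exists2 C, 0 <= C & forall n, `|t * S n| <= d * n.+1%:R + C.
Proof.
move=> d0; have t1 : 0 < `|t| + 1 by rewrite ltr_wpDl.
have [C C0 SC] := sum_sublinear (divr_gt0 d0 t1).
exists (`|t| * C) => [|n]; first exact: mulr_ge0.
rewrite normrM; apply: (le_trans (ler_wpM2l (normr_ge0 t) (SC n))).
rewrite mulrDr lerD2r mulrA ler_wpM2r // mulrA ler_pdivrMr // mulrC ler_wpM2l ?(ltW d0) //.
by rewrite lerDl.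
Qed.

(** Finiteness, which makes [fine] harmless. With [q = 2 + C] the terms are below a geometric
    series; with [q = - 2 - C] the term n = 0 is already at least 2. *)
Lemma pressure_bounds t : exists x : R, scaled_pressure t = x%:E.
Proof.
have [C C0 SC] := scaled_sublinear t ltr01.
have SC' n : - (n.+1%:R + C) <= t * S n <= n.+1%:R + C by have := SC n; rewrite mul1r ler_norml.
have up : (scaled_pressure t <= (ln 2 + (2 + C))%:E)%E.
  apply: scaled_pressure_le; first by rewrite addr_ge0.
  move=> N; apply: (@le_trans _ _ (\sum_(n < N) expR (- (n.+1%:R * 1)))).
    apply: ler_sum => n _; rewrite ler_expR.
    have /andP[_ h] := SC' n; have h1 : C <= n.+1%:R * C by rewrite ler_peMl // ler1n.
    lra.
  by apply: (le_trans (geometric_expR_le _ ltr01)); rewrite invr1 ler1n.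
have lo : ((ln 2 + (- 2 - C))%:E <= scaled_pressure t)%E.
  apply: (@scaled_pressure_ge _ _ 1); rewrite /partial_gen big_ord1 [nat_of_ord _]/=.
  apply: le_trans (expR_ge1Dx _); have /andP[h _] := SC' 0%N; lra.
move: up lo; case: (pressure _ _) => [x|//|//]; by exists x.
Qed.

Definition pressure_excess t := pressure_function a t - ln 2.

Lemma pressure_excessE t :
  scaled_pressure t = (ln 2 + pressure_excess t)%:E.
Proof.
have [x px] := pressure_bounds t.
by rewrite /pressure_excess /pressure_function px /= addrC subrK.
Qed.

Lemma pressure_excess_le t q : 0 <= q -> (forall N, partial_gen S N t q <= 2) -> pressure_excess t <= q.
Proof. by move=> q0 h; have := scaled_pressure_le q0 h; rewrite pressure_excessE lee_fin lerD2l. Qed.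

Lemma pressure_excess_ge t q N : 2 <= partial_gen S N t q -> q <= pressure_excess t.
Proof. by move=> h; have := scaled_pressure_ge h; rewrite pressure_excessE lee_fin lerD2l. Qed.

(* For [q < 0] a single late term of the generating function is already large. *)
Lemma pressure_excess_ge0 t : 0 <= pressure_excess t.
Proof.
apply/ler_addgt0Pr => e e0; rewrite -lerBlDr sub0r.
have e20 : 0 < e / 2 by rewrite divr_gt0.
have [C C0 SC] := scaled_sublinear t e20.
have [n _ /(_ n (leqnn n)) /= Hn] := near_le_natM (C + 1) e20.
apply: (@pressure_excess_ge _ _ n.+1); rewrite /partial_gen big_ord_recr /=.
rewrite -[leLHS]add0r; apply: lerD; first by apply: sumr_ge0 => i _; exact: expR_ge0.
apply: le_trans (expR_ge1Dx _).
have := SC n; rewrite ler_norml => /andP[h _].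
have : e / 2 * n.+1%:R = e / 2 * n%:R + e / 2 by rewrite -[n.+1%:R]natr1 mulrDr mulr1.
lra.
Qed.

Lemma pressure_functionD t h :
  pressure_function a t - pressure_function a h = pressure_excess t - pressure_excess h.
Proof. by rewrite /pressure_excess; ring. Qed.

Lemma derivable_pressure t : derivable pressure_excess t 1 -> derivable (pressure_function a) t 1.
Proof.
rewrite /derivable; under eq_fun do rewrite /= -pressure_functionD.
by [].
Qed.

Lemma derive1_pressure : derive1 (pressure_function a) = derive1 pressure_excess.
Proof.
by apply/funext => t; rewrite /derive1; under eq_fun do rewrite pressure_functionD.
Qed.

Lemma C1_pressure t : C1_at pressure_excess t -> C1_at (pressure_function a) t.
Proof.
move=> [d c]; split; last by rewrite derive1_pressure.
by apply: filterS d => s; exact: derivable_pressure.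
Qed.

Lemma pressure_function0 t : pressure_excess t = 0 -> pressure_function a t = ln 2.
Proof. by rewrite /pressure_excess => /eqP; rewrite subr_eq0 => /eqP. Qed.

End pressure_excess.

(** * Examples *)

Section examples.
Context {R : realType}.

(* The exponentials [exp (a_0 + ... + a_n)] of the examples; the perturbation
   [eps] makes [a_0] positive, hence creates the second phase transition. *)
Definition excursion_weight (eps : R) (g : nat -> R) (n : nat) : R :=
  if n is n'.+1 then (1 - eps) * g n' else 1 + eps.

Definition excursion_grid (b : nat -> R) (n : nat) : R :=
  if n is n'.+1 then ln (b n) - ln (b n') else ln (b 0%N).

Lemma sum_excursion_grid (b : nat -> R) n : \sum_(k < n.+1) excursion_grid b k = ln (b n).
Proof.
elim: n => [|n IH]; first by rewrite big_ord1.
by rewrite big_ord_recr /= IH addrC subrK.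
Qed.

Section weights.
Variables (eps : R) (g : nat -> R).
Hypotheses (eps0 : 0 <= eps :> R) (eps1 : eps <= 1 / 10 :> R).
Hypothesis g_gt0 : forall n, 0 < g n.
(** The total mass of [g] is 1, so the weights sum to (1 + eps) + (1 - eps) = 2. The two examples
    attain the extremes: [g 0] is 1/2 for the square and 2/3 for the cube, and the ratio with
    constant 3 is an equality for the cube; it forces [a] to tend to 0. *)
Hypothesis g_sum : forall N, 1 - 2 / N.+1%:R <= \sum_(n < N) g n <= 1.
Hypotheses (g0_ge : 1 / 2 <= g 0) (g0_le : g 0 <= 2 / 3).
Hypothesis g_ratio : forall n, g n.+1 <= g n <= (1 + 3 / n.+1%:R) * g n.+1.

Let b := excursion_weight eps g.
Let a := excursion_grid b.
Let S n : R := \sum_(k < n.+1) a k.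

Let b0E : b 0 = 1 + eps. Proof. by []. Qed.

Let bSE n : b n.+1 = (1 - eps) * g n. Proof. by []. Qed.

Lemma excursion_weight_gt0 n : 0 < b n.
Proof.
move: eps0 eps1 => e0 e1; case: n => [|n]; first by rewrite b0E; lra.
by rewrite bSE mulr_gt0 //; lra.
Qed.

Lemma expR_sum_grid n : expR (S n) = b n.
Proof. by rewrite /S sum_excursion_grid lnK // posrE excursion_weight_gt0. Qed.

Lemma cvg_excursion_grid : a n @[n --> \oo] --> (0 : R).
Proof.
rewrite -(cvg_shiftn 2) /=.
have h n : - (3 * n.+1%:R^-1) <= a (n + 2)%N <= 0.
  have /andP[r1 r2] := g_ratio n; have g1 := g_gt0 n.+1; have g0 := g_gt0 n.
  have e1 : 0 < 1 - eps by move: eps1; lra.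
  rewrite addn2 /a /excursion_grid !bSE !lnM ?posrE // opprD addrACA subrr add0r.
  rewrite subr_le0 ler_ln ?posrE // r1 andbT lerNl opprB lerBlDl.
  apply: (@le_trans _ _ (ln ((1 + 3 / n.+1%:R) * g n.+1))).
    by rewrite ler_ln ?posrE // (lt_le_trans g0).
  have p3 : 0 < 3 / n.+1%:R :> R by rewrite divr_gt0.
  rewrite lnM; [|by rewrite posrE addr_gt0|by rewrite posrE].
  by rewrite addrC lerD2l; apply: le_ln1Dx; apply: lt_trans p3; rewrite oppr_lt0.
apply: (@squeeze_cvgr _ _ _ _ (fun n => - (3 * n.+1%:R^-1)) (fun=> 0)).
- by near=> n; exact: h.
- rewrite -oppr0 -(mulr0 3); apply: cvgN; apply: cvgM; first exact: cvg_cst.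
  exact: cvg_harmonic.
- exact: cvg_cst.
Unshelve. all: by end_near. Qed.

Lemma sum_expS N : \sum_(n < N.+1) expR (S n) = 1 + eps + (1 - eps) * \sum_(n < N) g n.
Proof.
rewrite big_ord_recl expR_sum_grid big_distrr /=; congr (_ + _).
by apply: eq_bigr => n _; rewrite expR_sum_grid.
Qed.

Lemma sum_expS_le N : \sum_(n < N) expR (S n) <= 2.
Proof.
case: N => [|N]; first by rewrite big_ord0.
by rewrite sum_expS; have /andP[_ h] := g_sum N; move: eps0 eps1 => e0 e1; nra.
Qed.

Lemma sum_expS_cvg : (\sum_(n < N) expR (S n)) @[N --> \oo] --> (2 : R).
Proof.
rewrite -(cvg_shiftn 1) /=.
apply: (@squeeze_cvgr _ _ _ _ (fun N => 2 - 2 * N.+1%:R^-1) (fun=> 2)).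
- near=> N; rewrite addn1 sum_expS_le andbT sum_expS.
  have /andP[h _] := g_sum N.
  have p : 0 <= 2 / N.+1%:R :> R by rewrite divr_ge0.
  have e1 : 0 <= 1 - eps by move: eps1; lra.
  have := mulr_ge0 eps0 p; have := ler_wpM2l e1 h.
  move: (2 / N.+1%:R) (\sum_(n < N) g n) => P X; lra.
- rewrite -[X in _ --> X]subr0 -(mulr0 2); apply: cvgB; first exact: cvg_cst.
  by apply: cvgM; [exact: cvg_cst|exact: cvg_harmonic].
- exact: cvg_cst.
Unshelve. all: by end_near. Qed.

Lemma sum_grid_le0 n : (0 < n)%N -> S n <= 0.
Proof.
case: n => // n _; rewrite /S sum_excursion_grid; apply: ln_le0; rewrite bSE.
have gn : g n <= 1.
  have /andP[_] := g_sum n.+1; apply: le_trans; rewrite big_ord_recr /= lerDr.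
  by apply: sumr_ge0 => i _; exact: ltW.
have := g_gt0 n; move: eps0 eps1 => e0 e1; nra.
Qed.

Lemma sum_grid01 : expR (S 0) * S 0 + expR (S 1) * S 1 < 0.
Proof.
rewrite !expR_sum_grid /S !sum_excursion_grid.
have h (x : R) : 0 < x -> x * ln x <= x * (x - 1).
  move=> x0; apply: ler_wpM2l; first exact: ltW.
  by have := @le_ln1Dx R (x - 1); rewrite addrCA subrr addr0; apply; lra.
have h0 := h _ (excursion_weight_gt0 0); have h1 := h _ (excursion_weight_gt0 1).
apply: le_lt_trans (lerD h0 h1) _; rewrite b0E bSE.
move: eps0 eps1 g0_ge g0_le => e0 e1 j0 j1.
(* On [9/20, 2/3] one has x (x - 1) <= -2/9, which outweighs (1 + eps) eps <= 11/100. *)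
have k1 : 9 / 20 <= (1 - eps) * g 0 by nra.
have k2 : (1 - eps) * g 0 <= 2 / 3 by nra.
move: k1 k2; move: ((1 - eps) * g 0) => x k1 k2; nra.
Qed.

Let a0 := cvg_excursion_grid.
Let Q := pressure_excess a.

Lemma excursion_left_derivative (Dm : R) :
  (forall N, \sum_(n < N) n.+1%:R * b n <= Dm) ->
  exists2 l, is_left_derive (pressure_function a) 1 l & l < 0.
Proof.
move=> HD; have [|l Ql l0] := left_derivative (sum_sublinear a0) (pressure_excess_ge0 a0)
  (pressure_excess_le a0) (pressure_excess_ge a0) sum_expS_le sum_expS_cvg sum_grid_le0
  sum_grid01 (Dm := Dm).
  by move=> N; under eq_bigr do rewrite expR_sum_grid; exact: HD.
exists l => //; rewrite /is_left_derive; under eq_fun do rewrite pressure_functionD.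
exact: Ql.
Qed.

Lemma excursion_derivable_left t : t < 1 ->
  derivable (pressure_function a) t 1 /\ derive1 (pressure_function a) t < 0.
Proof.
move=> t1; have [r [dQ Qr r0 _]] := Q_derivable_left (sum_sublinear a0) (pressure_excess_ge0 a0)
  (pressure_excess_le a0) (pressure_excess_ge a0) sum_expS_le sum_expS_cvg sum_grid_le0
  sum_grid01 t1.
by rewrite derive1_pressure Qr; split => //; exact: derivable_pressure.
Qed.

Lemma excursion_flat t : eps = 0 -> 1 <= t -> pressure_function a t = ln 2.
Proof.
move=> e0 t1; apply: pressure_function0.
apply: (Q0_right (pressure_excess_ge0 a0) (pressure_excess_le a0) sum_expS_le sum_grid_le0 _ t1).
by rewrite sum_excursion_grid b0E e0 addr0 ln1.
Qed.

Lemma excursion_flat_interval : 0 < eps -> exists2 t1, 1 < t1 &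
  (forall t, 1 <= t <= t1 -> pressure_function a t = ln 2) /\
  (forall t, t1 < t -> derivable (pressure_function a) t 1 /\ 0 < derive1 (pressure_function a) t).
Proof.
move=> e0; have S0 : 0 < S 0 by rewrite /S sum_excursion_grid b0E ln_gt0 // ltrDl.
have [t1 t11 [flat pos]] := Q0_right_interval (pressure_excess_ge0 a0)
  (pressure_excess_le a0) (pressure_excess_ge a0) sum_expS_le sum_grid_le0 sum_grid01 S0.
exists t1 => //; split=> [t /flat|t t1t]; first exact: pressure_function0.
have [r [dQ Qr lo]] := Q_derivable (sum_sublinear a0) (pressure_excess_le a0)
  (pressure_excess_ge a0) (pos t t1t).
rewrite derive1_pressure Qr; split; first exact: derivable_pressure.
(* The supporting line at [t] must pass below 0 at [t1], while [Q t > 0]; hence its slope is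
   positive. *)
have := lo (t1 - t); rewrite (_ : t + (t1 - t) = t1); last by ring.
rewrite (flat t1) ?(ltW t11) ?lexx // => h; have := pos t t1t => Qt.
rewrite ltNge; apply/negP => r0.
by have := mulr_le0 r0 (_ : t1 - t <= 0); rewrite subr_le0 ltW // => /(_ isT); lra.
Qed.

Lemma excursion_C1 : (forall B, exists m, B <= \sum_(n < m) n.+1%:R * b n) ->
  C1_at (pressure_function a) 1.
Proof.
move=> HB; have [t1 t11 flat] : exists2 t1, 1 < t1 & forall t, 1 <= t <= t1 -> Q t = 0.
  have [e0|] := eqVneq eps 0.
    exists 2; first by rewrite ltr1n.
    by move=> t /andP[t1 _]; rewrite /Q /pressure_excess excursion_flat // subrr.
  move=> e0; have [|t1 t11 [flat _]] := excursion_flat_interval; first by rewrite lt_neqAle eq_sym e0.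
  by exists t1 => // t /flat; rewrite /Q /pressure_excess => ->; rewrite subrr.
apply: C1_pressure.
apply: (Q_C1_at1 (sum_sublinear a0) (pressure_excess_ge0 a0) (pressure_excess_le a0)
  (pressure_excess_ge a0) sum_expS_le sum_expS_cvg sum_grid_le0 sum_grid01 _ t11 flat).
by move=> B; have [m Hm] := HB B; exists m; under eq_bigr do rewrite expR_sum_grid.
Qed.

End weights.

(** This and [inverse_cube] are telescoping variants of n^-2 and n^-3 with total 1; the 4 below is
    the inverse of the sum of 1/((n+1)(n+2)(n+3)). *)
Definition inverse_square (n : nat) : R := (n.+1%:R * n.+2%:R)^-1.

Definition inverse_cube (n : nat) : R := 4 / (n.+1%:R * n.+2%:R * n.+3%:R).

Lemma inverse_square_gt0 n : 0 < inverse_square n.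
Proof. by rewrite invr_gt0 mulr_gt0. Qed.

Lemma inverse_cube_gt0 n : 0 < inverse_cube n.
Proof. by rewrite divr_gt0 // !mulr_gt0. Qed.

Lemma sum_inverse_square N : \sum_(n < N) inverse_square n = 1 - 1 / N.+1%:R.
Proof.
elim: N => [|N IH]; first by rewrite big_ord0 divr1 subrr.
have k0 : 0 < N.+1%:R :> R by [].
rewrite big_ord_recr /= IH /inverse_square -[N.+2%:R]natr1.
move: (N.+1%:R) k0 => k k0; have k1 : 0 < k + 1 by rewrite addr_gt0.
by field; rewrite !gt_eqF.
Qed.

Lemma sum_inverse_cube N : \sum_(n < N) inverse_cube n = 1 - 2 / (N.+1%:R * N.+2%:R).
Proof.
elim: N => [|N IH]; first by rewrite big_ord0 mul1r divff ?subrr // pnatr_eq0.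
have k0 : 0 < N.+1%:R :> R by [].
rewrite big_ord_recr /= IH /inverse_cube -[N.+3%:R]natr1 -[N.+2%:R]natr1.
move: (N.+1%:R) k0 => k k0; have k1 : 0 < k + 1 by rewrite addr_gt0.
have k2 : 0 < k + 1 + 1 by rewrite addr_gt0.
by field; rewrite !gt_eqF.
Qed.

Lemma inverse_square_sum N : 1 - 2 / N.+1%:R <= \sum_(n < N) inverse_square n <= 1.
Proof.
rewrite sum_inverse_square gerBl divr_ge0 // andbT lerD2l lerN2.
by rewrite ler_wpM2r // ?invr_ge0 // ler1n.
Qed.

Lemma inverse_cube_sum N : 1 - 2 / N.+1%:R <= \sum_(n < N) inverse_cube n <= 1.
Proof.
rewrite sum_inverse_cube gerBl divr_ge0 ?mulr_ge0 // andbT lerD2l lerN2.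
by rewrite ler_wpM2l // lef_pV2 ?posrE ?mulr_gt0 // ler_peMr // ler1n.
Qed.

Lemma inverse_square_ratio n :
  inverse_square n.+1 <= inverse_square n <= (1 + 3 / n.+1%:R) * inverse_square n.+1.
Proof.
have k0 : 0 < n.+1%:R :> R by [].
rewrite /inverse_square -[n.+3%:R]natr1 -[n.+2%:R]natr1; set k : R := n.+1%:R.
have [k1 k2] : 0 < k + 1 /\ 0 < k + 1 + 1 by rewrite /k; split; rewrite !addr_gt0.
rewrite lef_pV2 ?posrE ?mulr_gt0 //; apply/andP; split; first by nra.
rewrite -(ler_pM2r (_ : 0 < k * (k + 1) * (k + 1 + 1))) ?mulr_gt0 //.
have -> : (k * (k + 1))^-1 * (k * (k + 1) * (k + 1 + 1)) = k + 2.
  by field; rewrite !gt_eqF.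
have -> : (1 + 3 / k) * ((k + 1) * (k + 1 + 1))^-1 * (k * (k + 1) * (k + 1 + 1)) = k + 3.
  by field; rewrite !gt_eqF.
by rewrite lerD2l ler_nat.
Qed.

Lemma inverse_cube_ratio n :
  inverse_cube n.+1 <= inverse_cube n <= (1 + 3 / n.+1%:R) * inverse_cube n.+1.
Proof.
have k0 : 0 < n.+1%:R :> R by [].
rewrite /inverse_cube -[n.+4%:R]natr1 -[n.+3%:R]natr1 -[n.+2%:R]natr1; set k : R := n.+1%:R.
have [k1 k2] : 0 < k + 1 /\ 0 < k + 1 + 1 by rewrite /k; split; rewrite !addr_gt0.
have k3 : 0 < k + 1 + 1 + 1 by rewrite addr_gt0.
apply/andP; split.
  rewrite ler_wpM2l // lef_pV2 ?posrE ?mulr_gt0 //.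
  have := mulr_gt0 k1 k2; nra.
rewrite le_eqVlt; apply/orP; left; apply/eqP; field; rewrite !gt_eqF //.
Qed.

Lemma sum_excursion_weight eps g N : \sum_(n < N.+1) n.+1%:R * excursion_weight eps g n =
  1 + eps + (1 - eps) * \sum_(n < N) n.+2%:R * g n :> R.
Proof.
rewrite big_ord_recl /= mul1r big_distrr /=; congr (_ + _).
by apply: eq_bigr => n _; rewrite /bump /= mulrCA.
Qed.

Lemma inverse_cube_moment eps : 0 <= eps -> eps <= 1 / 10 ->
  forall N, \sum_(n < N) n.+1%:R * excursion_weight eps inverse_cube n <= 6.
Proof.
move=> e0 e1 [|N]; first by rewrite big_ord0.
rewrite sum_excursion_weight.
have h : \sum_(n < N) n.+2%:R * inverse_cube n <= 4.
  (* Termwise, 4/((n+1)(n+3)) is at most 4/((n+1)(n+2)). *)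
  apply: (@le_trans _ _ (4 * \sum_(n < N) inverse_square n)); last first.
    by have /andP[_ h] := inverse_square_sum N; lra.
  rewrite big_distrr /=; apply: ler_sum => n _; rewrite /inverse_cube /inverse_square.
  rewrite mulrCA ler_wpM2l //.
  have E (x y z : R) : 0 < x -> 0 < y -> 0 < z -> y * (x * y * z)^-1 = (x * z)^-1.
    by move=> x0 y0 z0; field; rewrite !gt_eqF.
  rewrite E //.
  by rewrite lef_pV2 ?posrE ?mulr_gt0 // ler_pM2l // ler_nat.
nra.
Qed.

Lemma inverse_square_moment eps : 0 <= eps -> eps <= 1 / 10 ->
  forall B, exists m, B <= \sum_(n < m) n.+1%:R * excursion_weight eps inverse_square n.
Proof.
move=> e0 e1 B; apply: contrapT => /forallNP hB.
have e2 : 0 < 1 - eps by lra.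
(* Bounded moments would bound the harmonic series, since [n.+2%:R * inverse_square n] is
   1/(n+1). *)
have : cvgn (series (@harmonic R)).
  apply: nondecreasing_is_cvgn.
    apply/nondecreasing_seqP => n; rewrite /series /= big_nat_recr //= lerDl.
    exact: harmonic_ge0.
  exists (B / (1 - eps)) => _ [N _ <-]; rewrite /series /= big_mkord.
  rewrite ler_pdivlMr // mulrC.
  have /negP := hB N.+1; rewrite -ltNge sum_excursion_weight => /ltW; apply: le_trans.
  rewrite -[leLHS]add0r; apply: lerD; first by lra.
  rewrite ler_pM2l //; apply: ler_sum => n _; rewrite /inverse_square /harmonic /=.
  by rewrite invfM mulrCA divff ?mulr1 // pnatr_eq0.
exact: dvg_harmonic.
Qed.

End examples.

Theorem theorem6p1 (R : realType) :
  [/\ (exists a : nat -> R,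
        [/\ a n @[n --> \oo] --> (0 : R),
            (exists2 l : R,
              is_left_derive (pressure_function a) 1 l & l < 0) &
            (forall t : R, 1 <= t -> pressure_function a t = ln 2)]),
      (exists (a : nat -> R) (t1 : R),
        [/\ a n @[n --> \oo] --> (0 : R),
            1 < t1,
            (exists2 l : R,
              is_left_derive (pressure_function a) 1 l & l < 0),
            (forall t : R, 1 <= t <= t1 -> pressure_function a t = ln 2) &
            (forall t : R, t1 < t ->
              derivable (pressure_function a) t 1 /\
              0 < derive1 (pressure_function a) t)]),
      (exists a : nat -> R,
        [/\ a n @[n --> \oo] --> (0 : R),
            (forall t : R, t < 1 ->
              derivable (pressure_function a) t 1 /\
              derive1 (pressure_function a) t < 0),
            C1_at (pressure_function a) 1 &
            (forall t : R, 1 <= t -> pressure_function a t = ln 2)]) &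
      (exists (a : nat -> R) (t1 : R),
        a n @[n --> \oo] --> (0 : R) /\
        [/\ 1 < t1,
            (forall t : R, t < 1 ->
              derivable (pressure_function a) t 1 /\
              derive1 (pressure_function a) t < 0),
            C1_at (pressure_function a) 1,
            (forall t : R, 1 <= t <= t1 -> pressure_function a t = ln 2) &
            (forall t : R, t1 < t ->
              derivable (pressure_function a) t 1 /\
              0 < derive1 (pressure_function a) t)])].
Proof.
have z0 : (0 : R) <= 0 by []. have z1 : (0 : R) <= 1 / 10 by rewrite divr_ge0.
have t0 : (0 : R) < 1 / 10 by rewrite divr_gt0.
have tt : (1 / 10 : R) <= 1 / 10 by [].
have sq0 : 1 / 2 <= inverse_square 0 :> R by rewrite /inverse_square; lra.
have sq1 : inverse_square 0 <= 2 / 3 :> R by rewrite /inverse_square; lra.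
have cu0 : 1 / 2 <= inverse_cube 0 :> R by rewrite /inverse_cube; lra.
have cu1 : inverse_cube 0 <= 2 / 3 :> R by rewrite /inverse_cube; lra.
have sqg := @inverse_square_gt0 R; have cug := @inverse_cube_gt0 R.
have sqs := @inverse_square_sum R; have cus := @inverse_cube_sum R.
have sqr := @inverse_square_ratio R; have cur := @inverse_cube_ratio R.
split.
- exists (excursion_grid (excursion_weight 0 (@inverse_cube R))); split.
  + exact: cvg_excursion_grid.
  + exact: excursion_left_derivative (inverse_cube_moment z0 z1).
  + by move=> t; exact: excursion_flat.
- have [t1 t11 [flat up]] := excursion_flat_interval z1 tt cug cus cu0 cu1 cur t0.
  exists (excursion_grid (excursion_weight (1 / 10) (@inverse_cube R))), t1; split => //.
  + exact: cvg_excursion_grid.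
  + exact: excursion_left_derivative (inverse_cube_moment z1 tt).
- exists (excursion_grid (excursion_weight 0 (@inverse_square R))); split.
  + exact: cvg_excursion_grid.
  + by move=> t; exact: excursion_derivable_left.
  + exact: excursion_C1 (inverse_square_moment z0 z1).
  + by move=> t; exact: excursion_flat.
- have [t1 t11 [flat up]] := excursion_flat_interval z1 tt sqg sqs sq0 sq1 sqr t0.
  exists (excursion_grid (excursion_weight (1 / 10) (@inverse_square R))), t1; split.
    exact: cvg_excursion_grid.
  split => //.
  + by move=> t; exact: excursion_derivable_left.
  + exact: excursion_C1 (inverse_square_moment z1 tt).
Qed.
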